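(* Let $m\in\mathbb{N}$, let $\alpha=\{\alpha_k\}_{k\in\mathbb{Z}}$ be a sequence of complex $m\times m$ matrices with operator norm $\|\alpha_k\|<1$ for all $k$, and let $\mathbb{U}_\alpha$ be the associated full-lattice CMV operator on $\ell^2(\mathbb{Z})^m$. Fix $k_0\in\mathbb{Z}$ and let $\alpha_{k_0}=\sigma_{k_0}\beta_{k_0}\tau_{k_0}^*$ be a factorization with $\sigma_{k_0},\tau_{k_0}\in\mathbb{C}^{m\times m}$ unitary and $\beta_{k_0}=\mathrm{diag}[\beta_{k_0,1},\dots,\beta_{k_0,m}]\in\mathbb{C}^{m\times m}$ diagonal. Let $t_1,\dots,t_m,s_1,\dots,s_m\in\mathbb{R}$, $\theta_1=\mathrm{diag}[e^{it_1},\dots,e^{it_m}]$, $\theta_2=\mathrm{diag}[e^{is_1},\dots,e^{is_m}]$, and $\gamma_j=\sigma_{k_0}\theta_j\tau_{k_0}^*$, $j=1,2$. Let $\mathbb{U}^{(\gamma_1,\gamma_2)}_{\alpha;k_0}$ be the unitary operator on $\ell^2(\mathbb{Z})^m$ defined by $$\mathbb{U}^{(\gamma_1,\gamma_2)}_{\alpha;k_0}=\mathbb{U}^{(\gamma_1)}_{\alpha;-,k_0-1}\oplus\mathbb{U}^{(\gamma_2)}_{\alpha;+,k_0},$$ and let $z\in\mathbb{C}$ with $|z|\ne1$. Then, for an arbitrary unitary matrix $\gamma\in\mathbb{C}^{m\times m}$, the difference $\mathbb{U}_\alpha-\mathbb{U}^{(\gamma)}_{\alpha;k_0}$ has rank greater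 than $m$, while the differences $\mathbb{U}_\alpha-\mathbb{U}^{(\gamma_1,\gamma_2)}_{\alpha;k_0}$ and $(\mathbb{U}_\alpha-zI)^{-1}-\big(\mathbb{U}^{(\gamma_1,\gamma_2)}_{\alpha;k_0}-zI\big)^{-1}$ are of rank $m$ if and only if $$t_j=2\arg\big[i(\beta_{k_0,j}e^{-is_j/2}-e^{is_j/2})\big]\quad(\text{mod }2\pi),\qquad j=1,\dots,m,$$ and otherwise possess rank greater than $m$.
   Context: Set $\rho_k=(I_m-\alpha_k^*\alpha_k)^{1/2}$, $\widetilde\rho_k=(I_m-\alpha_k\alpha_k^* )^{1/2}$ and $\Theta_k=\begin{pmatrix}-\alpha_k&\widetilde\rho_k\\ \rho_k&\alpha_k^*\end{pmatrix}$ (a unitary $2m\times2m$ matrix) for $k\in\mathbb{Z}$. Let $\mathbb{V}$ and $\mathbb{W}$ be the block-diagonal unitary operators on $\ell^2(\mathbb{Z})^m$ ($\mathbb{C}^m$-valued square-summable sequences; matrix entries are $m\times m$ blocks) such that for each even $k$, $\mathbb{V}$ has the block $\Theta_k$ in block rows and columns $(k-1,k)$; for each odd $k$, $\mathbb{W}$ has the block $\Theta_k$ in block rows and columns $(k-1,k)$; all other entries vanish. The (full-lattice) CMV operator is $\mathbb{U}=\mathbb{U}_\alpha=\mathbb{V}\mathbb{W}$. For a unitary $\gamma\in\mathbb{C}^{m\times m}$ and $k_0\in\mathbb{Z}$, replace $\alpha_{k_0}$ by $\gamma$ (so $\rho_{k_0},\widetilde\rho_{k_0}$ become $0$ and $\Theta_{k_0}$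 becomes $\mathrm{diag}(-\gamma,\gamma^* )$), leaving all other $\alpha_k$ unchanged. The resulting operators are denoted $\mathbb{V}^{(\gamma)}_{k_0},\mathbb{W}^{(\gamma)}_{k_0}$ and $\mathbb{U}^{(\gamma)}_{\alpha;k_0}=\mathbb{V}^{(\gamma)}_{k_0}\mathbb{W}^{(\gamma)}_{k_0}$; each splits as a direct sum of an operator on $\ell^2((-\infty,k_0-1]\cap\mathbb{Z})^m$ and one on $\ell^2([k_0,\infty)\cap\mathbb{Z})^m$, the summands being denoted with subscripts $-,k_0-1$ and $+,k_0$. Thus $\mathbb{U}^{(\gamma)}_{\alpha;k_0}=\mathbb{U}^{(\gamma)}_{\alpha;-,k_0-1}\oplus\mathbb{U}^{(\gamma)}_{\alpha;+,k_0}$. *)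

(* Defs.v *)
From HB Require Import structures.
From mathcomp Require Import all_boot all_order all_algebra.
From mathcomp Require Import spectral sesquilinear complex.
From mathcomp Require Import all_classical all_reals all_analysis.
From mathcomp Require Import zify.

Set Implicit Arguments.
Unset Strict Implicit.
Unset Printing Implicit Defensive.

Import Order.TTheory GRing.Theory Num.Theory.

Local Open Scope ring_scope.
Local Open Scope classical_set_scope.
Local Open Scope sesquilinear_scope.
Local Open Scope complex_scope.

Section Complex.
Variable R : realType.
Local Notation C := R[i].

Definition expi (t : R) : C := cos t +i* sin t.

(* The principal argument, in ]- pi, pi]; its value at 0 is irrelevant. *)
Definition carg (w : C) : R :=
  let a := acos (complex.Re w / Normc.normc w) in
  if 0 <= complex.Im w then a else - a.

Lemma carg_polar (w : C) : w = (Normc.normc w)%:C * expi (carg w).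
Proof.
have [->|w0] := eqVneq w 0; first by rewrite Normc.normc0 mul0r.
have n0 : Normc.normc w != 0 by apply: contra w0 => /eqP/Normc.eq0_normc ->.
have n_gt0 : 0 < Normc.normc w.
  by rewrite lt_def n0; case: (w) => a b; rewrite sqrtr_ge0.
have n2 : Normc.normc w ^+ 2 = complex.Re w ^+ 2 + complex.Im w ^+ 2.
  by case: (w) => a b /=; rewrite sqr_sqrtr ?addr_ge0 ?sqr_ge0.
rewrite /carg; move: (Normc.normc w) n0 n_gt0 n2 => r r0 r_gt0 r2.
have x2 : (complex.Re w / r) ^+ 2 <= 1.
  by rewrite expr_div_n ler_pdivrMr ?exprn_gt0// mul1r r2 lerDl sqr_ge0.
have x1 : -1 <= complex.Re w / r <= 1.
  by rewrite -ler_norml -(ler_pXn2r (n:=2)) ?nnegrE// expr1n real_normK ?num_real.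
have cosE : cos (acos (complex.Re w / r)) = complex.Re w / r.
  by apply: acosK; rewrite in_itv.
have sinE : sin (acos (complex.Re w / r)) = `|complex.Im w| / r.
  rewrite sin_acos//.
  have -> : 1 - (complex.Re w / r) ^+ 2 = (complex.Im w / r) ^+ 2.
    apply: (mulIf (expf_neq0 2 r0)); rewrite mulrBl !expr_div_n !divfK ?expf_neq0//.
    by rewrite mul1r r2 addrC addKr.
  by rewrite sqrtr_sqr normrM (gtr0_norm (x:=r^-1)) ?invr_gt0.
case: ifPn => [im0|]; rewrite /expi.
  apply/eqP; rewrite eq_complex/= cosE sinE ger0_norm// !mul0r subr0 addr0.
  by rewrite ![r * _]mulrC !divfK// !eqxx.
rewrite -ltNge => im0; rewrite cosN sinN.
apply/eqP; rewrite eq_complex/= cosE sinE ltr0_norm// !mul0r subr0 addr0.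
by rewrite mulNr opprK ![r * _]mulrC !divfK// !eqxx.
Qed.

End Complex.

Section Matrices.
Variables (R : realType) (m : nat).
Local Notation C := R[i].

Definition vnorm (x : 'cV[C]_m) : R :=
  Num.sqrt (\sum_(i < m) Normc.normc (x i 0) ^+ 2).

Definition opnorm (A : 'M[C]_m) : R :=
  sup [set vnorm (A *m x) | x in [set x | vnorm x <= 1]].

Definition psdmx (A : 'M[C]_m) : Prop :=
  A^t* = A /\ forall x : 'cV[C]_m, 0 <= (x^t* *m A *m x) 0 0.

(* The square root of a positive semidefinite matrix, by functional calculus;
   [psqrtmx_psd], [psqrtmxK] and [psqrtmx_uniq] characterize it. *)
Definition psqrtmx (A : 'M[C]_m) : 'M[C]_m :=
  invmx (spectralmx A) *m diag_mx (map_mx sqrtC (spectral_diag A))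
  *m spectralmx A.

Lemma psd_spectral A : psdmx A ->
  let P := spectralmx A in let d := spectral_diag A in
  [/\ A = P^t* *m diag_mx d *m P, P *m P^t* = 1%:M & forall i, 0 <= d 0 i].
Proof.
move=> [Ah Ap] P d.
have Pu : P \is unitarymx by exact: spectral_unitarymx.
have AE : A = P^t* *m diag_mx d *m P.
  rewrite -invmx_unitary//; apply/orthomx_spectralP/normalmxP.
  by rewrite Ah.
have PP : P *m P^t* = 1%:M by apply/unitarymxP.
split => // i; have := Ap (P^t* *m delta_mx i 0).
rewrite AE trmx_mul map_mxM trmxCK !mulmxA.
rewrite -2![_ *m P *m P^t*]mulmxA PP !mulmx1.
rewrite trmx_delta map_delta_mx -rowE !mxE (bigD1 i)//= big1 => [|j ji]; last first.
  by rewrite !mxE eq_sym (negPf ji) mul0r.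
by rewrite !mxE !eqxx mulr1n mulr1 addr0.
Qed.

Lemma psd_diag (P : 'M[C]_m) (d : 'rV[C]_m) : (forall i, 0 <= d 0 i) ->
  psdmx (P^t* *m diag_mx d *m P).
Proof.
move=> d0; split.
  rewrite !trmx_mul !map_mxM trmxCK mulmxA tr_diag_mx map_diag_mx.
  congr (_ *m diag_mx _ *m _); apply/rowP => i; rewrite !mxE.
  exact: geC0_conj.
move=> x; have -> : x^t* *m (P^t* *m diag_mx d *m P) *m x
    = (P *m x)^t* *m (diag_mx d *m (P *m x)).
  by rewrite trmx_mul map_mxM !mulmxA.
rewrite mul_diag_mx; move: (P *m x) => y.
rewrite mxE sumr_ge0// => i _; rewrite !mxE mulrCA.
by apply: mulr_ge0 => //; rewrite mulrC; exact: mul_conjC_ge0.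
Qed.

Lemma psqrtmxE A :
  psqrtmx A = (spectralmx A)^t* *m diag_mx (map_mx sqrtC (spectral_diag A))
              *m spectralmx A.
Proof. by rewrite /psqrtmx invmx_unitary ?spectral_unitarymx. Qed.

Lemma psqrtmx_psd A : psdmx A -> psdmx (psqrtmx A).
Proof.
move=> /psd_spectral[_ _ d0]; rewrite psqrtmxE; apply: psd_diag => i.
by rewrite mxE sqrtC_ge0.
Qed.

Lemma psqrtmxK A : psdmx A -> psqrtmx A *m psqrtmx A = A.
Proof.
move=> /psd_spectral[AE PP _]; rewrite [RHS]AE psqrtmxE !mulmxA.
rewrite -[_ *m spectralmx A *m _]mulmxA PP mulmx1; congr (_ *m _).
rewrite -mulmxA mulmx_diag; congr (_ *m diag_mx _).
by apply/rowP => i; rewrite !mxE -expr2 sqrtCK.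
Qed.

Lemma psqrtmx_uniq A B : psdmx A -> psdmx B -> B *m B = A -> B = psqrtmx A.
Proof.
move=> Apsd [Bh Bp] BB.
have [Sh Sp] := psqrtmx_psd Apsd; have := psqrtmxK Apsd.
move: (psqrtmx A) Sh Sp => S Sh Sp; rewrite -BB => SB.
set D := S - B; suff : D = 0 by move/subr0_eq.
have Dh : D^t* = D by rewrite /D linearB/= map_mxB Sh Bh.
have Pu := spectral_unitarymx D.
have PP : spectralmx D *m (spectralmx D)^t* = 1%:M by apply/unitarymxP.
have DE : D = (spectralmx D)^t* *m diag_mx (spectral_diag D) *m spectralmx D.
  by rewrite -invmx_unitary//; apply/orthomx_spectralP/normalmxP; rewrite Dh.
move: (spectralmx D) (spectral_diag D) Pu PP DE => P d Pu PP DE.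
suff -> : D = P^t* *m diag_mx 0 *m P.
  by rewrite linear0 mulmx0 mul0mx.
rewrite [LHS]DE; congr (_ *m diag_mx _ *m _); apply/rowP => i; rewrite [RHS]mxE.
pose x : 'cV[C]_m := P^t* *m delta_mx i 0.
have Dx : D *m x = d 0 i *: x.
  rewrite {1}DE /x !mulmxA -[_ *m P *m P^t*]mulmxA PP mulmx1 -mulmxA.
  rewrite scalemxAr; congr (_ *m _); apply/colP => j; rewrite mul_diag_mx !mxE.
  by case: (eqVneq j i) => [->|_]; rewrite ?mulr0.
have xD : x^t* *m D = d 0 i *: x^t*.
  rewrite {1}DE /x trmx_mul map_mxM trmxCK trmx_delta map_delta_mx !mulmxA.
  rewrite -[_ *m P *m _]mulmxA PP mulmx1 scalemxAl; congr (_ *m _).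
  apply/rowP => j; rewrite mul_mx_diag !mxE.
  by case: (eqVneq j i) => [->|_]; rewrite ?andbF ?mulr0 ?mul0r // mulrC.
have xx : (x^t* *m x) 0 0 = 1.
  rewrite /x trmx_mul map_mxM trmxCK mulmxA -[_ *m P *m _]mulmxA PP mulmx1.
  by rewrite trmx_delta map_delta_mx mul_delta_mx mxE.
move: x Dx xD xx => x Dx xD xx.
have key : d 0 i * ((x^t* *m S *m x) 0 0 + (x^t* *m B *m x) 0 0) = 0.
  have : x^t* *m (S *m D + D *m B) *m x = 0.
    rewrite /D mulmxBr mulmxBl SB addrA subrK subrr.
    by rewrite mulmx0 mul0mx.
  rewrite mulmxDr mulmxDl !mulmxA -[_ *m D *m x]mulmxA Dx xD.
  rewrite -scalemxAr -!scalemxAl -scalerDr => /matrixP /(_ 0 0).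
  by rewrite mxE [X in _ * X]mxE [in RHS]mxE => ->.
move/eqP: key; rewrite mulf_eq0 => /orP[/eqP//|].
rewrite paddr_eq0// => /andP[/eqP S0 /eqP B0].
have : (x^t* *m D *m x) 0 0 = 0.
  by rewrite /D mulmxBr mulmxBl mxE [X in _ + X]mxE S0 B0 subrr.
by rewrite xD -scalemxAl mxE xx mulr1.
Qed.

Definition phasemx (t : 'I_m -> R) : 'M[C]_m := diag_mx (\row_j expi (t j)).

End Matrices.

Section Operators.
Variables (R : realType) (m : nat).
Local Notation C := R[i].

Definition lseq := int -> 'cV[C]_m.

Definition l2 : set lseq :=
  [set f | summable [set: int] (fun k => ((vnorm (f k)) ^+ 2)%:E)].

(* Operators on l2 are given as maps on all sequences; only their values on l2
   matter for the inverse and the rank below. *)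

(* The inverse on l2 of an operator T that maps l2 bijectively onto l2, as
   U - z does when U is unitary on l2 and `|z| != 1. *)
Definition l2inv (T : lseq -> lseq) : lseq -> lseq :=
  fun g => xget 0 [set f | l2 f /\ T f = g].

Definition resolvent (T : lseq -> lseq) (z : C) : lseq -> lseq :=
  l2inv (fun f => T f - z *: f).

Definition lin_indep n (v : 'I_n -> lseq) : Prop :=
  forall c : 'I_n -> C, \sum_(i < n) c i *: v i = 0 -> forall i, c i = 0.

(* The rank of a linear T is the dimension of its range T @` l2, which may be
   infinite. *)
Definition rank_eq (T : lseq -> lseq) (n : nat) : Prop :=
  exists v : 'I_n -> lseq,
    [/\ forall i, (T @` l2) (v i), lin_indep v
      & forall g, (T @` l2) g -> exists c : 'I_n -> C,
          g = \sum_(i < n) c i *: v i].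

Definition rank_gt (T : lseq -> lseq) (n : nat) : Prop :=
  exists v : 'I_n.+1 -> lseq, (forall i, (T @` l2) (v i)) /\ lin_indep v.

End Operators.

Section CMV.
Variables (R : realType) (m : nat).
Local Notation C := R[i].
Local Notation lseq := (lseq R m).

Implicit Types (alpha : int -> 'M[C]_m) (gamma : 'M[C]_m).

Definition rho (a : 'M[C]_m) : 'M[C]_m := psqrtmx (1%:M - a^t* *m a).
Definition rhot (a : 'M[C]_m) : 'M[C]_m := psqrtmx (1%:M - a *m a^t*).

Definition Theta (a : 'M[C]_m) : 'M[C]_(m + m) :=
  block_mx (- a) (rhot a) (rho a) (a^t*).

Definition evenz (k : int) : bool := (2 %| k)%Z.

(* The block diagonal operator with block B k in block rows and columns
   (k - 1, k), for every k such that p k, where p selects one parity class: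
   row j is the lower row of the block B j if p j, and otherwise the upper row
   of the block B (j + 1). *)
Definition blockdiag (p : pred int) (B : int -> 'M[C]_(m + m)) (f : lseq) :
    lseq := fun j =>
  if p j then dlsubmx (B j) *m f (j - 1) + drsubmx (B j) *m f j
  else ulsubmx (B (j + 1)) *m f j + ursubmx (B (j + 1)) *m f (j + 1).

Definition cmvV alpha : lseq -> lseq :=
  blockdiag evenz (fun k => Theta (alpha k)).

Definition cmvW alpha : lseq -> lseq :=
  blockdiag (fun k => ~~ evenz k) (fun k => Theta (alpha k)).

Definition cmvU alpha : lseq -> lseq := cmvV alpha \o cmvW alpha.

Definition replace alpha (k0 : int) gamma : int -> 'M[C]_m :=
  fun k => if k == k0 then gamma else alpha k.

Definition cmvUg alpha k0 gamma : lseq -> lseq :=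
  cmvU (replace alpha k0 gamma).

(* Sequences on a half-lattice are identified with their extension by 0. *)
Definition cutl (k0 : int) (f : lseq) : lseq := fun k => if k <= k0 - 1 then f k else 0.
Definition cutr (k0 : int) (f : lseq) : lseq := fun k => if k0 <= k then f k else 0.

(* The summands of [cmvUg alpha k0 gamma] on the half-lattices ]-oo, k0 - 1]
   and [k0, +oo[; see [cmvUg_split]. *)
Definition cmvUgl alpha k0 gamma : lseq -> lseq :=
  cutl k0 \o cmvUg alpha k0 gamma \o cutl k0.
Definition cmvUgr alpha k0 gamma : lseq -> lseq :=
  cutr k0 \o cmvUg alpha k0 gamma \o cutr k0.

Definition cmvUgg alpha k0 gamma1 gamma2 : lseq -> lseq :=
  fun f => cmvUgl alpha k0 gamma1 f + cmvUgr alpha k0 gamma2 f.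

Lemma psqrtmx0 : psqrtmx (0 : 'M[C]_m) = 0.
Proof.
have p0 : psdmx (0 : 'M[C]_m).
  by split=> [|x]; rewrite ?mulmx0 ?mul0mx ?mxE// trmx0 map_mx0.
by apply/esym/psqrtmx_uniq; rewrite ?mulmx0.
Qed.

Lemma Theta_unitary gamma : gamma \is unitarymx ->
  Theta gamma = block_mx (- gamma) 0 0 (gamma^t*).
Proof.
move=> gU; have gg : gamma *m gamma^t* = 1%:M by apply/unitarymxP.
by rewrite /Theta /rho /rhot gg (mulmx1C gg) subrr psqrtmx0.
Qed.

Lemma blockdiag_cut p (B : int -> 'M[C]_(m + m)) k0 f :
    ursubmx (B k0) = 0 -> dlsubmx (B k0) = 0 ->
  blockdiag p B (cutl k0 f) = cutl k0 (blockdiag p B f) /\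
  blockdiag p B (cutr k0 f) = cutr k0 (blockdiag p B f).
Proof.
move=> ur0 dl0; split; apply/funext => j; rewrite /blockdiag /cutl /cutr.
- have [pj|pj] := ifPn.
    have [->|jk] := eqVneq j k0.
      have -> : (k0 <= k0 - 1) = false by lia.
      by rewrite dl0 mul0mx mulmx0 addr0.
    have -> : (j - 1 <= k0 - 1) = (j <= k0 - 1) by lia.
    by case: ifP => // _; rewrite !mulmx0 addr0.
  have [jk|jk] := eqVneq (j + 1) k0.
    have -> : (j + 1 <= k0 - 1) = false by lia.
    have -> : (j <= k0 - 1) = true by lia.
    by rewrite jk ur0 !mul0mx.
  have -> : (j + 1 <= k0 - 1) = (j <= k0 - 1) by lia.
  by case: ifP => // _; rewrite !mulmx0 addr0.
- have [pj|pj] := ifPn.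
    have [->|jk] := eqVneq j k0.
      by rewrite lexx dl0 !mul0mx.
    have -> : (k0 <= j - 1) = (k0 <= j) by lia.
    by case: ifP => // _; rewrite !mulmx0 addr0.
  have [jk|jk] := eqVneq (j + 1) k0.
    have -> : (k0 <= j) = false by lia.
    by rewrite jk ur0 mul0mx mulmx0 addr0.
  have -> : (k0 <= j + 1) = (k0 <= j) by lia.
  by case: ifP => // _; rewrite !mulmx0 addr0.
Qed.

Lemma cmvUg_split alpha k0 gamma : gamma \is unitarymx ->
  cmvUg alpha k0 gamma = cmvUgg alpha k0 gamma gamma.
Proof.
move=> gU; apply/funext => f.
have B0 : Theta (replace alpha k0 gamma k0) = block_mx (- gamma) 0 0 (gamma^t*).
  by rewrite /replace eqxx Theta_unitary.
have UE g : cmvUg alpha k0 gamma (cutl k0 g) = cutl k0 (cmvUg alpha k0 gamma g)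
         /\ cmvUg alpha k0 gamma (cutr k0 g) = cutr k0 (cmvUg alpha k0 gamma g).
  rewrite /cmvUg /cmvU /cmvV /cmvW /=.
  pose cut p h := @blockdiag_cut p
    (fun k => Theta (replace alpha k0 gamma k)) k0 h.
  have {}cut p h := cut p h (etrans (congr1 _ B0) (block_mxKur _ _ _ _))
    (etrans (congr1 _ B0) (block_mxKdl _ _ _ _)).
  by rewrite (cut _ g).1 (cut _ g).2 (cut _ _).1 (cut _ _).2.
rewrite /cmvUgg /cmvUgl /cmvUgr /= (UE f).1 (UE f).2.
apply/funext => j; rewrite /cutl /cutr.
change (cmvUg alpha k0 gamma f j =
  (if j <= k0 - 1 then if j <= k0 - 1 then cmvUg alpha k0 gamma f j else 0
   else 0) +
  (if k0 <= j then if k0 <= j then cmvUg alpha k0 gamma f j else 0 else 0)).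
have -> : (k0 <= j) = ~~ (j <= k0 - 1) by lia.
by case: (j <= k0 - 1); rewrite /= ?addr0 ?add0r.
Qed.

End CMV.

(* Main.v *)
Require Import Defs.
From HB Require Import structures.
From mathcomp Require Import all_boot all_order all_algebra.
From mathcomp Require Import spectral sesquilinear complex.
From mathcomp Require Import all_classical all_reals all_analysis.
From mathcomp Require Import zify ring lra.

Import numFieldNormedType.Exports.
Import Order.TTheory GRing.Theory Num.Theory.
Local Open Scope ring_scope.
Local Open Scope sesquilinear_scope.
Local Open Scope complex_scope.

(** Both full-lattice operators are products of two layers of unitary 2m x 2m
    blocks, an even and an odd one ([layers]), and the half-lattice operators
    glued together at k0 form such a product too ([cmvUgg_layers]). They differ
    in one block only, the one at k0. Hence the difference of the operators is
    J E P, where E is the difference of the two blocks, P is onto the space of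
    pairs of vectors and J is injective ([layers_diff]), and its rank is the
    rank of the matrix E ([rank_eq_factor], [rank_gt_factor]).

    The second resolvent identity writes the difference of the resolvents as
    the difference of the operators composed on both sides with bijections of
    the square-summable sequences, so the same matrix E gives its rank
    ([rank_resolvent_diff]). That U - z is bijective when |z| <> 1 follows from
    the Neumann series for U or for its inverse ([neumann]).

    It remains to compute the rank of the matrix E with rows
    (gamma1 - a, rhot a) and (rho a, (a - gamma2)^* ), where a = alpha k0. As
    rhot a is invertible, the rank is m plus the rank of the Schur complement
    rho a - (a - gamma2)^* (rhot a)^-1 (gamma1 - a) ([rank_coupling]).

    When gamma1 = gamma2 the Schur complement is, up to unitaries, positive
    definite, so the rank exceeds m ([rank_decoupled_unitary]). When gamma1 and
    gamma2 are diagonal in the same bases as a, it is a diagonal matrix, with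
    j-th entry r - (b - exp(i s))^* r^-1 (exp(i t) - b) for b = beta_j and
    r^2 = 1 - |b|^2. This vanishes exactly when
    exp(i t) = (1 - b exp(-i s)) / (b^* - exp(-i s)), and the right-hand side is
    w / w^* for w = i (b exp(-i s / 2) - exp(i s / 2)), that is exp(2 i arg w)
    ([angle_condition]). Thus the rank is m when all these equations hold, and
    otherwise larger. *)

(** * Adjoints and contractions *)

Section Adjoint.
Set Implicit Arguments.
Unset Strict Implicit.
Variable C : numClosedFieldType.

Lemma adj_mul n p q (A : 'M[C]_(n, p)) (B : 'M[C]_(p, q)) :
  (A *m B)^t* = B^t* *m A^t*.
Proof. by rewrite trmx_mul map_mxM. Qed.

Lemma adj_sub n p (A B : 'M[C]_(n, p)) : (A - B)^t* = A^t* - B^t*.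
Proof. by apply/matrixP => i j; rewrite !mxE rmorphB. Qed.

Lemma adj_opp n p (A : 'M[C]_(n, p)) : (- A)^t* = - A^t*.
Proof. by apply/matrixP => i j; rewrite !mxE rmorphN. Qed.

Lemma adj1 n : (1%:M : 'M[C]_n)^t* = 1%:M.
Proof. by rewrite trmx1 map_mx1. Qed.

Lemma adj_diag n (d : 'rV[C]_n) : (diag_mx d)^t* = diag_mx (map_mx Num.conj d).
Proof. by rewrite tr_diag_mx map_diag_mx. Qed.

Lemma adj_block n1 n2 p1 p2 (A : 'M[C]_(n1, p1)) (B : 'M[C]_(n1, p2))
    (A' : 'M[C]_(n2, p1)) (B' : 'M[C]_(n2, p2)) :
  (block_mx A B A' B')^t* = block_mx (A^t*) (A'^t*) (B^t*) (B'^t*).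
Proof. by rewrite tr_block_mx map_block_mx. Qed.

End Adjoint.

Section SquaredNorm.
Set Implicit Arguments.
Unset Strict Implicit.
Variable R : realType.
Local Notation C := R[i].

Definition nsq n (x : 'cV[C]_n) : R := \sum_i Normc.normc (x i 0) ^+ 2.

Lemma vnorm_sqr n (x : 'cV[C]_n) : vnorm x ^+ 2 = nsq x.
Proof. by rewrite sqr_sqrtr// sumr_ge0// => i _; rewrite sqr_ge0. Qed.

Lemma vnorm_ge0 n (x : 'cV[C]_n) : 0 <= vnorm x.
Proof. exact: sqrtr_ge0. Qed.

Lemma vnorm_le1 n (x : 'cV[C]_n) : (vnorm x <= 1) = (nsq x <= 1).
Proof. by rewrite -vnorm_sqr expr_le1 ?vnorm_ge0. Qed.

Lemma normc_ge0 (c : C) : 0 <= Normc.normc c.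
Proof. by case: c => a b; exact: sqrtr_ge0. Qed.

Lemma normc_mul_conj (c : C) : c^*%R * c = (Normc.normc c ^+ 2)%:C.
Proof. by rewrite mulrC -normCK rmorphXn. Qed.

Lemma nsqE n (x : 'cV[C]_n) : (x^t* *m x) 0 0 = (nsq x)%:C.
Proof.
by rewrite mxE rmorph_sum; apply: eq_bigr => i _; rewrite !mxE normc_mul_conj.
Qed.

Lemma nsq_ge0 n (x : 'cV[C]_n) : 0 <= nsq x.
Proof. by apply: sumr_ge0 => i _; rewrite sqr_ge0. Qed.

Lemma nsq_entry n (x : 'cV[C]_n) i : Normc.normc (x i 0) ^+ 2 <= nsq x.
Proof.
by rewrite /nsq (bigD1 i)//= lerDl sumr_ge0// => j _; rewrite sqr_ge0.
Qed.

Lemma nsq_eq0 n (x : 'cV[C]_n) : nsq x <= 0 -> x = 0.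
Proof.
move=> x0; apply/colP => i; rewrite mxE; apply: Normc.eq0_normc; apply/eqP.
by rewrite -sqrf_eq0 -[_ == 0]andTb eq_le sqr_ge0 andbT (le_trans (nsq_entry x i)).
Qed.

Lemma nsqZ n c (x : 'cV[C]_n) : nsq (c *: x) = Normc.normc c ^+ 2 * nsq x.
Proof.
rewrite /nsq mulr_sumr; apply: eq_bigr => i _.
by rewrite mxE Normc.normcM exprMn.
Qed.

Lemma nsq0 n : nsq (0 : 'cV[C]_n) = 0.
Proof. by rewrite /nsq big1// => i _; rewrite mxE Normc.normc0 expr0n. Qed.

Lemma nsq_col_mx n p (x : 'cV[C]_n) (y : 'cV[C]_p) :
  nsq (col_mx x y) = nsq x + nsq y.
Proof.
rewrite /nsq big_split_ord; congr (_ + _); apply: eq_bigr => i _.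
  by rewrite col_mxEu.
by rewrite col_mxEd.
Qed.

Lemma nsq_mul n p (B : 'M[C]_(p, n)) (x : 'cV[C]_n) :
  (nsq (B *m x))%:C = (x^t* *m (B^t* *m B) *m x) 0 0.
Proof. by rewrite -nsqE adj_mul !mulmxA. Qed.

Lemma nsq_isometry n p (B : 'M[C]_(p, n)) (x : 'cV[C]_n) :
  B^t* *m B = 1%:M -> nsq (B *m x) = nsq x.
Proof. by move=> BB; apply: complexI; rewrite nsq_mul BB mulmx1 nsqE. Qed.

(** Minkowski's inequality in disguise: choosing a and b proportional to the
    norms of x and y gives the triangle inequality. Unlike the latter this
    form is additive in the squared norms, so it can be summed over any
    index set. In each coordinate the difference of the two sides is a sum
    of squares divided by a * b. *)
Lemma nsqD_le n (x y : 'cV[C]_n) (a b : R) : 0 < a -> 0 < b ->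
  nsq (x + y) <= (a + b) * (nsq x / a + nsq y / b).
Proof.
move=> a0 b0; rewrite /nsq !mulr_suml -big_split mulr_sumr /=.
apply: ler_sum => i _; rewrite mxE.
case: (x i 0) (y i 0) => [p q] [u v] /=.
rewrite !sqr_sqrtr ?addr_ge0 ?sqr_ge0 //.
rewrite -subr_ge0.
have -> : (a + b) * ((p ^+ 2 + q ^+ 2) / a + (u ^+ 2 + v ^+ 2) / b) -
  ((p + u) ^+ 2 + (q + v) ^+ 2)
  = ((b * p - a * u) ^+ 2 + (b * q - a * v) ^+ 2) / (a * b).
  by field; rewrite !gt_eqF.
by rewrite divr_ge0 ?addr_ge0 ?sqr_ge0 ?mulr_ge0 ?ltW.
Qed.

End SquaredNorm.

Section Contractions.
Set Implicit Arguments.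
Unset Strict Implicit.
Variables (R : realType) (m : nat).
Local Notation C := R[i].
Implicit Types A : 'M[C]_m.

(** The supremum of an unbounded set is 0 by convention, so boundedness has
    to be known before a bound on [opnorm] says anything. A crude entrywise
    estimate suffices. *)
Lemma opnorm_has_sup A :
  has_sup [set vnorm (A *m x) | x in [set x | vnorm x <= 1]]%classic.
Proof.
split.
  by exists (vnorm (A *m 0)); exists 0 => //=; rewrite vnorm_le1 nsq0.
exists (Num.sqrt (\sum_i (\sum_j Normc.normc (A i j)) ^+ 2)) => _ [x /= x1 <-].
apply: ler_wsqrtr; apply: ler_sum => i _.
rewrite lerXn2r ?nnegrE ?normc_ge0 ?sumr_ge0// => [j _|]; first exact: normc_ge0.
rewrite mxE -lecR rmorph_sum.
change (`|\sum_j A i j * x j 0| <= \sum_j `|A i j|).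
apply: le_trans (ler_norm_sum _ _ _) _; apply: ler_sum => j _.
rewrite normrM ler_piMr//.
change ((Normc.normc (x j 0))%:C <= 1%:C); rewrite lecR.
rewrite -(@expr_le1 _ 2) ?normc_ge0// (le_trans (nsq_entry _ _))//.
by rewrite -vnorm_le1.
Qed.

Lemma opnorm_lt1 A x : opnorm A < 1 -> x != 0 -> nsq (A *m x) < nsq x.
Proof.
move=> A1 x0; have n0 : 0 < nsq x.
  rewrite lt_def nsq_ge0 andbT; apply: contra x0 => /eqP n0.
  by rewrite (@nsq_eq0 _ _ x)// n0.
pose c := (Num.sqrt (nsq x))^-1.
have cE : Normc.normc (c%:C : C) ^+ 2 = (nsq x)^-1.
  by rewrite /= expr0n addr0 sqr_sqrtr ?sqr_ge0// exprVn sqr_sqrtr ?nsq_ge0.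
have le_op : vnorm (A *m (c%:C *: x)) <= opnorm A.
  apply: (ub_le_sup (opnorm_has_sup A).2); exists (c%:C *: x) => //=.
  by rewrite vnorm_le1 nsqZ cE mulVf ?gt_eqF.
have := le_lt_trans le_op A1; rewrite -(@expr_lt1 _ 2) ?vnorm_ge0//.
by rewrite vnorm_sqr -scalemxAr nsqZ cE mulrC ltr_pdivrMr// mul1r.
Qed.

Definition contraction A := forall x, nsq (A *m x) <= nsq x.

Lemma opnorm_contraction A : opnorm A < 1 -> contraction A.
Proof.
move=> A1 x; have [->|x0] := eqVneq x 0; first by rewrite mulmx0 !nsq0.
exact/ltW/opnorm_lt1.
Qed.

(** With u = A^t* *m y, expanding the square of the norm of y - A u gives
    |y|^2 - 2 |u|^2 + |A u|^2 >= 0, and |A u| <= |u| because A is a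
    contraction. *)
Lemma contraction_adj A : contraction A -> contraction (A^t*).
Proof.
move=> Ac y; have := nsq_ge0 (y - A *m (A^t* *m y)).
have := Ac (A^t* *m y); set u := A^t* *m y => Au.
suff -> : nsq (y - A *m u) = nsq y - nsq u *+ 2 + nsq (A *m u).
  by move: (nsq u) (nsq y) (nsq _) Au => a b c; lra.
have yA : y^t* *m A = u^t* by rewrite /u adj_mul trmxCK.
apply: complexI; rewrite rmorphD rmorphB rmorphMn /= -!nsqE.
rewrite adj_sub mulmxBl !mulmxBr adj_mul.
rewrite [y^t* *m (A *m u)]mulmxA yA.
rewrite -[_ *m A^t* *m y]mulmxA -/u.
have B11 (X Y : 'M[C]_1) : (X - Y) 0 0 = X 0 0 - Y 0 0 by rewrite !mxE.
by rewrite !B11; ring.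
Qed.

Lemma defect_mul A :
  (1%:M - A *m A^t*) *m A = A *m (1%:M - A^t* *m A).
Proof. by rewrite mulmxBl mul1mx mulmxBr mulmx1 mulmxA. Qed.

Lemma defect_psd A : contraction A -> psdmx (1%:M - A^t* *m A).
Proof.
move=> Ac; split.
  by rewrite adj_sub adj1 adj_mul trmxCK.
move=> x; rewrite mulmxBr mulmxBl mulmx1 mxE [X in _ + X]mxE.
by rewrite -nsq_mul nsqE subr_ge0 lecR.
Qed.

(** In eigenbases of A and B the matrix X becomes some Y with a_i Y_ij =
    Y_ij b_j, so that Y_ij vanishes unless a_i = b_j, and then the square
    roots of a_i and b_j agree as well. *)
Lemma psqrt_intertwine A B (X : 'M[C]_m) : psdmx A -> psdmx B ->
  A *m X = X *m B -> psqrtmx A *m X = X *m psqrtmx B.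
Proof.
move=> Ap Bp; rewrite !psqrtmxE.
have [AE PP _] := psd_spectral Ap.
have [BE QQ _] := psd_spectral Bp.
have PP' := mulmx1C PP; have QQ' := mulmx1C QQ.
move: (spectralmx A) (spectral_diag A) (spectralmx B) (spectral_diag B)
  AE BE PP QQ PP' QQ'.
move=> P a Q b -> -> PP QQ PP' QQ' AX.
pose Y := P *m X *m Q^t*.
have XY : X = P^t* *m Y *m Q by rewrite /Y !mulmxA PP' mul1mx -mulmxA QQ' mulmx1.
have dY : diag_mx a *m Y = Y *m diag_mx b.
  have := congr1 (fun Z : 'M[C]_m => P *m Z *m Q^t*) AX; rewrite /Y !mulmxA PP mul1mx => ->.
  by rewrite -[_ *m Q *m _]mulmxA QQ mulmx1.
have sY : diag_mx (map_mx sqrtC a) *m Y = Y *m diag_mx (map_mx sqrtC b).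
  apply/matrixP => i j; have /matrixP/(_ i j) := dY.
  rewrite !mul_diag_mx !mul_mx_diag !mxE mulrC => /eqP.
  rewrite -subr_eq0 -mulrBr mulf_eq0 => /orP[/eqP->|]; first by rewrite mulr0 mul0r.
  by rewrite subr_eq0 => /eqP->; rewrite mulrC.
clearbody Y; rewrite XY !mulmxA -[_ *m P *m P^t*]mulmxA PP mulmx1.
rewrite -[_ *m Q *m Q^t*]mulmxA QQ mulmx1 -[_ *m _ *m Y]mulmxA sY.
by rewrite !mulmxA.
Qed.

(** The diagonal blocks are the definitions of the two defect operators; the
    off-diagonal ones cancel because rhot A and rho A are intertwined by A. *)
Lemma Theta_isometry A : contraction A -> (Theta A)^t* *m Theta A = 1%:M.
Proof.
move=> Ac; have Ac' := contraction_adj Ac.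
have p1 := defect_psd Ac; have := defect_psd Ac'; rewrite trmxCK => p2.
have rK : rho A *m rho A = 1%:M - A^t* *m A by exact: psqrtmxK.
have sK : rhot A *m rhot A = 1%:M - A *m A^t* by exact: psqrtmxK.
have sA : rhot A *m A = A *m rho A.
  exact: (psqrt_intertwine p2 p1 (defect_mul A)).
have rh : (rho A)^t* = rho A := (psqrtmx_psd p1).1.
have sh : (rhot A)^t* = rhot A := (psqrtmx_psd p2).1.
rewrite /Theta adj_block mulmx_block rh sh trmxCK adj_opp.
have rA : A^t* *m rhot A = rho A *m A^t*.
  by rewrite -{1}sh -adj_mul sA adj_mul rh.
rewrite !mulmxN !mulNmx opprK rK sK sA rA !addNr subrK.
by rewrite addrC subrK -scalar_mx_block.
Qed.

End Contractions.

(** * Unimodular numbers and the angle condition *)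

Section Angles.
Set Implicit Arguments.
Unset Strict Implicit.
Variable R : realType.
Local Notation C := R[i].
Local Notation twopi := (2 * pi : R).

Lemma conjM (x y : C) : (x * y)^*%R = x^*%R * y^*%R.
Proof. exact: rmorphM. Qed.

Lemma conjB (x y : C) : (x - y)^*%R = x^*%R - y^*%R.
Proof. exact: rmorphB. Qed.

Lemma expiD (x y : R) : expi (x + y) = expi x * expi y.
Proof.
apply/eqP; rewrite eq_complex /= cosD sinD eqxx /=.
by rewrite addrC.
Qed.

Lemma expi0 : expi (0 : R) = 1.
Proof. by rewrite /expi cos0 sin0. Qed.

Lemma expi_conj (x : R) : (expi x)^*%R = expi (- x).
Proof. by rewrite /expi cosN sinN. Qed.

Lemma expi_mul_conj (x : R) : expi x * (expi x)^*%R = 1.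
Proof. by rewrite expi_conj -expiD subrr expi0. Qed.

Lemma expi_neq0 (x : R) : expi x != 0.
Proof.
by apply: contra_eq_neq (expi_mul_conj x) => ->; rewrite mul0r eq_sym oner_eq0.
Qed.

Lemma expi_twopi_nat n : expi (n%:R * twopi) = 1.
Proof.
elim: n => [|n IHn]; first by rewrite mul0r expi0.
rewrite -addn1 natrD mulrDl mul1r expiD IHn mul1r mulr_natl.
by rewrite /expi cos2pi sin2pi.
Qed.

Lemma expi_twopi_int (n : int) : expi (n%:~R * twopi) = 1.
Proof.
case: n => n; first exact: expi_twopi_nat.
rewrite NegzE mulrNz mulNr -expi_conj -[_%:~R]/(_%:R) expi_twopi_nat.
exact: rmorph1.
Qed.

(** Remove the integer part of x / (2 pi): what remains is a zero of sin in
    [0, 2 pi[, that is 0 or pi, and cos excludes pi. *)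
Lemma expi_eq1 (x : R) : expi x = 1 -> exists n : int, x = n%:~R * twopi.
Proof.
move=> x1; have pi0 := pi_gt0 R.
exists (Num.floor (x / twopi)); set n := Num.floor _.
(* y is the representative of x in [0, 2 pi[ *)
pose y := x - n%:~R * twopi.
have y_ge0 : 0 <= y by rewrite subr_ge0 -ler_pdivlMr ?mulr_gt0// floor_le_tmp.
have y_lt : y < twopi.
  rewrite ltrBlDr -[X in X + _]mul1r -mulrDl -ltr_pdivrMr ?mulr_gt0//.
  by rewrite addrC -(intrD _ n 1) floorD1_gt.
have [cosy siny] : cos y = 1 /\ sin y = 0.
  have : expi y = 1 by rewrite expiD -mulNr -mulrNz expi_twopi_int mulr1.
  by case.
suff y0 : y = 0 by apply/eqP; rewrite -subr_eq0 -/y y0.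
have [//|y_neq0] := eqVneq y 0.
have y_gt0 : 0 < y by rewrite lt_def y_neq0.
have [y_pi|pi_y|y_pi] := ltgtP y pi.
- by have := @sin_gt0_pi R y; rewrite siny ltxx y_gt0 y_pi => /(_ isT).
- have := @sin_gt0_pi R (y - pi).
  rewrite sinB siny cospi sinpi mulr0 mul0r subrr ltxx subr_gt0 pi_y ltrBlDr.
  by rewrite -mulr2n -mulr_natl y_lt => /(_ isT).
- by move: cosy; rewrite y_pi cospi => /eqP; rewrite lt_eqF// ltrN10.
Qed.

Lemma expi_eqP (x y : R) :
  expi x = expi y <-> exists n : int, x = y + n%:~R * twopi.
Proof.
split=> [xy|[n ->]]; last by rewrite expiD expi_twopi_int mulr1.
have /expi_eq1[n nE] : expi (x - y) = 1.
  by rewrite expiD xy -expi_conj expi_mul_conj.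
by exists n; rewrite -nE addrC subrK.
Qed.

(** The scalar heart of the theorem. Multiplying the Schur complement by r
    and using r^2 = 1 - |b|^2 leaves 1 - b e^-1 = (b^* - e^-1) expi t, where
    e = expi s. Multiplied by - i expi (s / 2), this reads w = w^* expi t,
    where w is the argument of [carg]; as w <> 0, it says that expi t is
    w / w^*, the square of the phase of w. *)
Lemma angle_condition (b : C) (s t r : R) : Normc.normc b < 1 ->
    r != 0 -> r ^+ 2 = 1 - Normc.normc b ^+ 2 ->
  r%:C - (b - expi s)^*%R * (r%:C^-1 * (expi t - b)) = 0 <->
  exists n : int,
    t = 2 * carg ('i%C * (b * expi (- s / 2) - expi (s / 2))) + n%:~R * twopi.
Proof.
move=> b1 r0 r2; set w := 'i%C * _; rewrite -expi_eqP.
pose u : C := expi (s / 2).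
have uu : u * u^*%R = 1 by exact: expi_mul_conj.
have u0 : u != 0 by exact: expi_neq0.
have uN : expi (- s / 2) = u^*%R by rewrite mulNr -expi_conj.
have sE : expi s = u * u by rewrite -expiD -splitr.
have w0 : w != 0.
  rewrite mulf_neq0//; first by rewrite eq_complex /= oner_eq0 andbF.
  rewrite subr_eq0 uN; apply: contraTneq b1 => /(congr1 (fun x => x * u)).
  rewrite -mulrA [_^*%R * _]mulrC uu mulr1 -leNgt => ->.
  suff -> : Normc.normc (u * u) = 1 by [].
  by rewrite -expiD /= cos2Dsin2 sqrtr1.
have wE : w = w^*%R * expi (2 * carg w).
  move: (carg_polar w); move: (Normc.normc w) (carg w) => a c ->.
  have aR : (a%:C)^*%R = a%:C by apply/eqP; rewrite eq_complex /= oppr0 !eqxx.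
  by rewrite conjM aR expi_conj -mulrA -expiD mulr_natl mulr2n addKr.
have wJ0 : w^*%R != 0 by rewrite fmorph_eq0.
have -> : (expi t = expi (2 * carg w)) <-> w = w^*%R * expi t.
  by split=> [->//|wt]; apply: (mulfI wJ0); rewrite -wE -wt.
have r2C : r%:C ^+ 2 = 1 - b^*%R * b by rewrite -rmorphXn /= r2 rmorphB normc_mul_conj.
have rC0 : r%:C != 0 by rewrite -(rmorph0 (real_complex R)) (inj_eq (@complexI R)).
have ii : ('i%C : C)^*%R = - 'i%C by apply/eqP; rewrite eq_complex /= oppr0 !eqxx.
have i0 : ('i%C : C) != 0 by rewrite eq_complex /= oner_eq0 andbF.
have wJ : w^*%R = - 'i%C * (b^*%R * u - u^*%R).
  by rewrite /w conjM conjB conjM ii uN conjCK.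
rewrite wJ /w uN conjB sE conjM.
move: (expi t) uu r2C rC0 i0 u0; move: (u^*%R) (b^*%R) (r%:C) ('i%C : C).
move=> v c rho i e uv r2C rC0 i0 u0.
have -> : (rho - (c - v * v) * (rho^-1 * (e - b)) = 0) <->
   (1 - v * v * b - (c - v * v) * e = 0).
  have -> : 1 - v * v * b - (c - v * v) * e =
    rho * (rho - (c - v * v) * (rho^-1 * (e - b))).
    rewrite mulrBr -[rho * rho]expr2 r2C [in RHS]mulrCA mulVKf//.
    ring.
  split=> [->|/eqP]; first by rewrite mulr0.
  by rewrite mulf_eq0 (negPf rC0) => /eqP.
have key : i * (b * v - u) - - i * (c * u - v) * e
   = - (i * u) * (1 - v * v * b - (c - v * v) * e).
  transitivity (- (i * u) + i * (u * v) * v * b + i * (u * c - (u * v) * v) * e).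
    by rewrite uv; ring.
  ring.
split=> [E|/eqP].
  by apply/eqP; rewrite -subr_eq0 key E mulr0.
by rewrite -subr_eq0 key mulf_eq0 oppr_eq0 mulf_eq0 (negPf i0) (negPf u0) => /eqP.
Qed.

End Angles.

(** * The rank of the local perturbation *)

Section SchurComplement.
Set Implicit Arguments.
Unset Strict Implicit.
Variables (F : fieldType) (m : nat).

Lemma rank_mul_unit n (P A Q : 'M[F]_n) : P \in unitmx -> Q \in unitmx ->
  \rank (P *m A *m Q) = \rank A.
Proof.
move=> Pu Qu; rewrite mxrankMfree ?row_free_unit//.
by rewrite (eqmxMfull A) ?row_full_unit.
Qed.

(** Row and column operations by block triangular matrices, with B as pivot,
    reduce the matrix to the direct sum of B and its Schur complement. *)
Lemma rank_block_schur (A B A' B' : 'M[F]_m) : B \in unitmx ->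
  \rank (block_mx A B A' B') = (m + \rank (A' - B' *m invmx B *m A)%R)%N.
Proof.
move=> Bu; set S := A' - _.
pose L : 'M[F]_(m + m) := block_mx 1%:M 0 (B' *m invmx B) 1%:M.
pose Q : 'M[F]_(m + m) := block_mx (invmx B *m A) 1%:M 1%:M 0.
have Lu : L \in unitmx.
  apply: (@mulmx1_unit _ _ _ (block_mx 1%:M 0 (- (B' *m invmx B)) 1%:M) _).1.
  rewrite mulmx_block !(mulmx0, mul0mx, mulmx1, mul1mx, addr0, add0r) subrr.
  by rewrite -scalar_mx_block.
have Qu : Q \in unitmx.
  apply: (@mulmx1_unit _ _ _ (block_mx 0 1%:M 1%:M (- (invmx B *m A))) _).1.
  rewrite mulmx_block !(mulmx0, mul0mx, mulmx1, mul1mx, addr0, add0r) subrr.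
  by rewrite -scalar_mx_block.
have -> : block_mx A B A' B' = L *m block_mx B 0 0 S *m Q.
  rewrite !mulmx_block !(mulmx0, mul0mx, mulmx1, mul1mx, addr0, add0r).
  by rewrite !mulmxKV// !mulmxA mulmxV// mul1mx addrC subrK.
by rewrite rank_mul_unit// rank_diag_block_mx mxrank_unit.
Qed.

End SchurComplement.

Section Coupling.
Set Implicit Arguments.
Unset Strict Implicit.
Variables (R : realType) (m : nat).
Local Notation C := R[i].
Variables (a sigma tau : 'M[C]_m) (beta : 'I_m -> C).
Hypothesis a_lt1 : opnorm a < 1.
Hypotheses (sigmaU : sigma \is unitarymx) (tauU : tau \is unitarymx).
Local Notation Beta := (diag_mx (\row_j beta j)).
Hypothesis aE : a = sigma *m Beta *m tau^t*.

Let sigmaK : sigma^t* *m sigma = 1%:M.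
Proof. exact/mulmx1C/unitarymxP. Qed.
Let sigmaVK : sigma *m sigma^t* = 1%:M.
Proof. exact/unitarymxP. Qed.
Let tauK : tau^t* *m tau = 1%:M.
Proof. exact/mulmx1C/unitarymxP. Qed.
Let tauVK : tau *m tau^t* = 1%:M.
Proof. exact/unitarymxP. Qed.

(** The matrix Theta g when g1 = g2 = g is unitary; taking different
    unitaries in the two corners is what distinguishes the operator built
    from gamma1 and gamma2. *)
Definition decoupled (g1 g2 : 'M[C]_m) : 'M[C]_(m + m) :=
  block_mx (- g1) 0 0 (g2^t*).

(** The vector tau e_j is mapped to beta_j sigma e_j, and sigma and tau
    preserve norms. *)
Lemma beta_lt1 j : Normc.normc (beta j) < 1.
Proof.
pose x : 'cV[C]_m := tau *m delta_mx j 0.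
have dj : nsq (delta_mx j 0 : 'cV[C]_m) = 1.
  rewrite /nsq (bigD1 j)//= big1 => [|i ij]; rewrite mxE ?(negPf ij).
    by rewrite !eqxx Normc.normc1 expr1n addr0.
  by rewrite Normc.normc0 expr0n.
have x1 : nsq x = 1 by rewrite nsq_isometry.
have x0 : x != 0 by apply: contra_eq_neq x1 => ->; rewrite nsq0 eq_sym oner_eq0.
have := opnorm_lt1 a_lt1 x0; rewrite x1 aE /x -!mulmxA [tau^t* *m _]mulmxA tauK.
rewrite mul1mx nsq_isometry//.
have -> : Beta *m delta_mx j 0 = beta j *: (delta_mx j 0 : 'cV[C]_m).
  apply/colP => i; rewrite mul_diag_mx !mxE.
  by have [->|] := eqVneq i j; rewrite ?mulr0.
by rewrite nsqZ dj mulr1 expr_lt1// normc_ge0.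
Qed.

Definition drho j : R := Num.sqrt (1 - Normc.normc (beta j) ^+ 2).

Lemma drho_gt0 j : 0 < drho j.
Proof. by rewrite sqrtr_gt0 subr_gt0 expr_lt1 ?normc_ge0 ?beta_lt1. Qed.

Lemma drho_sqr j : drho j ^+ 2 = 1 - Normc.normc (beta j) ^+ 2.
Proof. by rewrite sqr_sqrtr// ltW// subr_gt0 expr_lt1 ?normc_ge0 ?beta_lt1. Qed.

Local Notation Rho := (diag_mx (\row_j (drho j)%:C)).

Lemma psd_Rho (P : 'M[C]_m) : psdmx (P *m Rho *m P^t*).
Proof.
rewrite -{1}[P]trmxCK; apply: psd_diag => j.
by rewrite mxE -[0]/(0%:C) lecR ltW// drho_gt0.
Qed.

Lemma Rho_sqr : Rho *m Rho = 1%:M - Beta^t* *m Beta.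
Proof.
rewrite adj_diag !mulmx_diag -diag_const_mx -linearB; congr diag_mx.
apply/rowP => j; rewrite !mxE normc_mul_conj -rmorphM -expr2 drho_sqr.
by rewrite rmorphB.
Qed.

(** The diagonalization of a also diagonalizes its defect operators;
    positive square roots are unique. *)
Lemma rhotE : rhot a = sigma *m Rho *m sigma^t*.
Proof.
symmetry; apply: psqrtmx_uniq; last 2 first.
- exact: psd_Rho.
- rewrite !mulmxA -[_ *m sigma^t* *m sigma]mulmxA sigmaK mulmx1.
  rewrite -[_ *m Rho *m Rho]mulmxA Rho_sqr mulmxBr mulmxBl mulmx1 sigmaVK.
  congr (_ - _); rewrite aE !adj_mul trmxCK !mulmxA.
  rewrite -[_ *m tau^t* *m tau]mulmxA tauK mulmx1.
  congr (_ *m _); rewrite -!mulmxA; congr (_ *m _).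
  by rewrite adj_diag !mulmx_diag; congr diag_mx; apply/rowP => j; rewrite !mxE mulrC.
- rewrite -{1}[a]trmxCK; apply: defect_psd; exact/contraction_adj/opnorm_contraction.
Qed.

Lemma rhoE : rho a = tau *m Rho *m tau^t*.
Proof.
symmetry; apply: psqrtmx_uniq; last 2 first.
- exact: psd_Rho.
- rewrite !mulmxA -[_ *m tau^t* *m tau]mulmxA tauK mulmx1.
  rewrite -[_ *m Rho *m Rho]mulmxA Rho_sqr mulmxBr mulmxBl mulmx1 tauVK.
  congr (_ - _); rewrite aE !adj_mul trmxCK !mulmxA.
  by rewrite -[_ *m sigma^t* *m sigma]mulmxA sigmaK mulmx1.
- exact/defect_psd/opnorm_contraction.
Qed.

Lemma Rho_inv : invmx Rho = diag_mx (\row_j ((drho j)%:C)^-1).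
Proof.
have rr : Rho *m diag_mx (\row_j ((drho j)%:C)^-1) = 1%:M.
  rewrite mulmx_diag -diag_const_mx; congr diag_mx; apply/rowP => j; rewrite !mxE.
  by rewrite mulfV// -(rmorph0 (real_complex R)) (inj_eq (@complexI R)) gt_eqF ?drho_gt0.
by rewrite -[RHS]mul1mx -(mulVmx (mulmx1_unit rr).1) -mulmxA rr mulmx1.
Qed.

(** The Schur complement of the coupling block Theta a - decoupled g1 g2,
    where g_i = sigma G_i tau^*, in the bases given by sigma and tau. *)
Definition schur (G1 G2 : 'M[C]_m) : 'M[C]_m :=
  Rho - (Beta - G2)^t* *m invmx Rho *m (G1 - Beta).

Lemma rank_coupling (G1 G2 : 'M[C]_m) :
  \rank (Theta a - decoupled (sigma *m G1 *m tau^t*) (sigma *m G2 *m tau^t*))%R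
  = (m + \rank (schur G1 G2))%N.
Proof.
have Ru : Rho \in unitmx.
  rewrite unitmxE det_diag unitfE prodf_seq_neq0; apply/allP => j _ /=.
  by rewrite mxE -(rmorph0 (real_complex R)) (inj_eq (@complexI R)) gt_eqF ?drho_gt0.
rewrite -(rank_block_schur (G1 - Beta) Rho ((Beta - G2)^t*) Ru).
set E0 := block_mx (G1 - _) _ _ _.
have -> : Theta a - decoupled (sigma *m G1 *m tau^t*) (sigma *m G2 *m tau^t*)
  = block_mx sigma 0 0 tau *m E0 *m block_mx (tau^t*) 0 0 (sigma^t*).
  rewrite /Theta /decoupled opp_block_mx add_block_mx !mulmx_block.
  rewrite !(mulmx0, mul0mx, addr0, add0r, oppr0) rhotE rhoE opprK.
  congr block_mx; first by rewrite aE addrC -mulmxBl -mulmxBr.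
  by rewrite -adj_sub aE -mulmxBl -mulmxBr !adj_mul trmxCK mulmxA.
rewrite rank_mul_unit//.
  apply: (@mulmx1_unit _ _ _ (block_mx (sigma^t*) 0 0 (tau^t*)) _).1.
  rewrite mulmx_block !(mulmx0, mul0mx, addr0, add0r) sigmaVK tauVK.
  by rewrite -scalar_mx_block.
apply: (@mulmx1_unit _ _ _ (block_mx tau 0 0 sigma) _).1.
rewrite mulmx_block !(mulmx0, mul0mx, addr0, add0r) sigmaK tauK.
by rewrite -scalar_mx_block.
Qed.

(** For G1 = G2 = G the Schur complement is Rho + Y^* Rho^-1 Y with Y = G -
    Beta, the sum of a positive definite and a positive semidefinite matrix. *)
Lemma schur_diag_neq0 G i : schur G G i i != 0.
Proof.
set Y := G - Beta.
have -> : schur G G = Rho + Y^t* *m invmx Rho *m Y.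
  by rewrite /schur -[Beta - G]opprB adj_opp !mulNmx opprK.
rewrite gt_eqF// Rho_inv -mulmxA mxE ltr_pwDl//.
  by rewrite !mxE eqxx mulr1n -[0]/(0%:C) ltcR drho_gt0.
rewrite mul_diag_mx mxE sumr_ge0// => j _; rewrite !mxE mulrCA mulr_ge0//.
  by rewrite invr_ge0 -[0]/(0%:C) lecR ltW// drho_gt0.
by rewrite mulrC mul_conjC_ge0.
Qed.

(** Every g is sigma G tau^* for some G, so [schur_diag_neq0]
    applies; a matrix of positive size has at least one diagonal entry. *)
Lemma rank_decoupled_unitary (g : 'M[C]_m) : (0 < m)%N ->
  (m < \rank (Theta a - decoupled g g)%R)%N.
Proof.
move=> m_gt0; pose G := sigma^t* *m g *m tau.
have -> : g = sigma *m G *m tau^t*.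
  by rewrite /G !mulmxA sigmaVK mul1mx -mulmxA tauVK mulmx1.
rewrite rank_coupling -[X in (X < _)%N]addn0 ltn_add2l lt0n mxrank_eq0.
apply: contra_neq (schur_diag_neq0 G (Ordinal m_gt0)) => ->.
by rewrite mxE.
Qed.

(** For diagonal phases the Schur complement is itself diagonal, and its
    entries are those of [angle_condition]. *)
Lemma rank_decoupled_phase (t s : 'I_m -> R) :
  \rank (Theta a - decoupled (sigma *m phasemx t *m tau^t*)
                             (sigma *m phasemx s *m tau^t*))%R = m <->
  forall j : 'I_m, exists n : int,
    t j = 2 * carg ('i%C * (beta j * expi (- s j / 2) - expi (s j / 2)))
          + n%:~R * (2 * pi).
Proof.
rewrite rank_coupling.
have schurE : schur (phasemx t) (phasemx s) = diag_mx (\row_j ((drho j)%:C -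
    (beta j - expi (s j))^*%R * (((drho j)%:C)^-1 * (expi (t j) - beta j)))).
  rewrite /schur Rho_inv /phasemx -!linearB /= adj_diag -mulmxA !mulmx_diag -linearB /=.
  by congr diag_mx; apply/rowP => j; rewrite !mxE.
split=> [rk j|ang].
  apply/(angle_condition _ _ (beta_lt1 j) (lt0r_neq0 (drho_gt0 j)) (drho_sqr j)).
  have /eqP : \rank (schur (phasemx t) (phasemx s)) = 0%N.
    by apply/eqP; rewrite -(eqn_add2l m) rk addn0.
  by rewrite mxrank_eq0 schurE => /eqP/matrixP/(_ j j); rewrite !mxE eqxx mulr1n.
apply/eqP; rewrite -[X in _ == X]addn0 eqn_add2l mxrank_eq0 schurE.
apply/eqP/matrixP => i j; rewrite !mxE.
rewrite (angle_condition _ _ (beta_lt1 i) (lt0r_neq0 (drho_gt0 i)) (drho_sqr i)).2 ?mul0rn//.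
Qed.

Lemma rank_decoupled_ge (g1 g2 : 'M[C]_m) : (m <= \rank (Theta a - decoupled g1 g2)%R)%N.
Proof.
have -> : g1 = sigma *m (sigma^t* *m g1 *m tau) *m tau^t*.
  by rewrite !mulmxA sigmaVK mul1mx -mulmxA tauVK mulmx1.
have -> : g2 = sigma *m (sigma^t* *m g2 *m tau) *m tau^t*.
  by rewrite !mulmxA sigmaVK mul1mx -mulmxA tauVK mulmx1.
by rewrite rank_coupling leq_addr.
Qed.

End Coupling.

(** * Square-summable sequences *)

Section SquareSummable.
Set Implicit Arguments.
Unset Strict Implicit.
Variables (R : realType) (m : nat).
Local Notation C := R[i].
Local Open Scope classical_set_scope.
Local Notation lseq := (lseq R m).
Implicit Types (f g h : lseq) (M N : R) (S T : lseq -> lseq).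

(** The square-summable sequences of norm at most M, expressed by finite
    partial sums so that bounds can be checked on finitely many coordinates
    at a time. *)
Definition l2le M f :=
  forall s : seq int, uniq s -> \sum_(k <- s) nsq (f k) <= M ^+ 2.

Lemma l2P f : l2 f <-> exists2 M, 0 <= M & l2le M f.
Proof.
rewrite /l2 /= /summable; split=> [fin|[M M0 fM]].
- set E := esum _ _ in fin.
  have E0 : (0 <= E)%E by apply: esum_ge0 => k _; exact: abse_ge0.
  have Efin : E \is a fin_num by rewrite ge0_fin_numE.
  (* 1 + a is a bound whose square exceeds a, whatever a >= 0 *)
  exists (1 + fine E); first by rewrite addr_ge0// fine_ge0.
  move=> s us; have le_E : \sum_(k <- s) nsq (f k) <= fine E.
    rewrite -lee_fin fineK// -sumEFin fsbig_seq//=.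
    apply: esum_ge; exists [set` s]%classic.
      by split; [exact: finite_seq | exact: subsetT].
    rewrite le_eqVlt; apply/orP; left; apply/eqP.
    by apply: eq_fsbigr => k _; rewrite vnorm_sqr /= ger0_norm ?nsq_ge0.
  have := fine_ge0 E0; move: (fine E) le_E => K le_K K0.
  apply: (le_trans le_K); nra.
- apply: (@le_lt_trans _ _ (M ^+ 2)%:E); last exact: ltry.
  apply: ge_ereal_sup => _ [A [Afin _] <-].
  rewrite fsbig_finite//= (eq_bigr (fun k => (nsq (f k))%:E)) => [|k _].
    by rewrite sumEFin lee_fin; apply: fM; exact: finmap.fset_uniq.
  by rewrite vnorm_sqr ger0_norm ?nsq_ge0.
Qed.

Lemma l2le0 f : l2le 0 f -> f = 0.
Proof.
move=> f0; apply/funext => k; apply: nsq_eq0.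
by have := f0 [:: k] isT; rewrite big_seq1 expr0n.
Qed.

Lemma l2le_le M N f : 0 <= M -> M <= N -> l2le M f -> l2le N f.
Proof.
move=> M0 MN fM s us; apply: le_trans (fM s us) _.
by rewrite lerXn2r ?nnegrE// (le_trans M0).
Qed.

Lemma l2le_zero M : 0 <= M -> l2le M (0 : lseq).
Proof.
by move=> M0 s _; rewrite big1 ?exprn_ge0// => k _; rewrite [X in nsq X]/(0) nsq0.
Qed.

(** The constants M and N serve as weights in [nsqD_le], which makes its
    right-hand side exactly (M + N)^2. *)
Lemma l2leD M N f g : 0 <= M -> 0 <= N -> l2le M f -> l2le N g ->
  l2le (M + N) (f + g).
Proof.
move=> M0 N0 fM gN.
have [M00|M_neq0] := eqVneq M 0.
  by move: fM; rewrite M00 => /l2le0 ->; rewrite !add0r.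
have [N00|N_neq0] := eqVneq N 0.
  by move: gN; rewrite N00 => /l2le0 ->; rewrite !addr0.
have {M0 M_neq0}M0 : 0 < M by rewrite lt_def M_neq0.
have {N0 N_neq0}N0 : 0 < N by rewrite lt_def N_neq0.
move=> s us.
apply: (@le_trans _ _ ((M + N) * ((\sum_(k <- s) nsq (f k)) / M
    + (\sum_(k <- s) nsq (g k)) / N))).
  rewrite !mulr_suml -big_split mulr_sumr /=; apply: ler_sum => k _.
  exact: nsqD_le.
rewrite expr2; apply: ler_wpM2l; first by rewrite addr_ge0 ?ltW.
by apply: lerD; rewrite ler_pdivrMr// -expr2; [exact: fM | exact: gN].
Qed.

Lemma l2leZ M c f : l2le M f -> l2le (Normc.normc c * M) (c *: f).
Proof.
move=> fM s us; rewrite exprMn (eq_bigr (fun k => Normc.normc c ^+ 2 * nsq (f k))).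
  by rewrite -mulr_sumr ler_wpM2l ?sqr_ge0//; exact: fM.
by move=> k _; rewrite -nsqZ.
Qed.

Lemma l2D f g : l2 f -> l2 g -> l2 (f + g).
Proof.
move=> /l2P[M M0 fM] /l2P[N N0 gN]; apply/l2P.
by exists (M + N); [rewrite addr_ge0 | exact: l2leD].
Qed.

Lemma l2Z c f : l2 f -> l2 (c *: f).
Proof.
move=> /l2P[M M0 fM]; apply/l2P.
by exists (Normc.normc c * M); [rewrite mulr_ge0 ?normc_ge0 | exact: l2leZ].
Qed.

Lemma l2N f : l2 f -> l2 (- f).
Proof. by rewrite -scaleN1r; exact: l2Z. Qed.

Lemma l2B f g : l2 f -> l2 g -> l2 (f - g).
Proof. by move=> lf lg; apply: l2D => //; exact: l2N. Qed.

Lemma l2le_eq0 f (M : nat -> R) : (forall n, 0 <= M n) -> M @ \oo --> 0 ->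
  (forall n, l2le (M n) f) -> f = 0.
Proof.
move=> M0 Mcvg fM; apply: l2le0 => s us.
have sqcvg : M n ^+ 2 @[n --> \oo] --> (0 ^+ 2 : R).
  by rewrite expr2; exact: (cvgM Mcvg Mcvg).
rewrite -(cvg_lim _ sqcvg)//; apply: limr_ge; first by apply/cvg_ex; exists (0 ^+ 2).
by apply: nearW => n; exact: fM.
Qed.

Definition is_linear S := forall c f g, S (c *: f + g) = c *: S f + S g.

Lemma lin0 S : is_linear S -> S 0 = 0.
Proof.
move=> Sl; have := Sl (-1) 0 0; rewrite scaler0 addr0 scaleN1r addNr.
by [].
Qed.

Lemma linZ S c f : is_linear S -> S (c *: f) = c *: S f.
Proof. by move=> Sl; have := Sl c f 0; rewrite (lin0 Sl) !addr0. Qed.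

Lemma linD S f g : is_linear S -> S (f + g) = S f + S g.
Proof. by move=> Sl; have := Sl 1 f g; rewrite !scale1r. Qed.

Lemma linB S f g : is_linear S -> S (f - g) = S f - S g.
Proof. by move=> Sl; rewrite linD// -scaleN1r linZ// scaleN1r. Qed.

(** Stated by bounds on the norm, so that no value of the norm has to be
    computed. *)
Definition l2_contraction S := forall M f, l2le M f -> l2le M (S f).

Lemma contr_l2 S f : l2_contraction S -> l2 f -> l2 (S f).
Proof. by move=> Sc /l2P[M M0 fM]; apply/l2P; exists M => //; exact: Sc. Qed.

(** Iterating f = c S f shows that the norm of f is at most |c|^n M for
    every n. *)
Lemma fixpoint_eq0 S c f : l2_contraction S -> Normc.normc c < 1 -> l2 f ->
  f = c *: S f -> f = 0.
Proof.
move=> Sc c1 /l2P[M M0 fM] fE.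
apply: (@l2le_eq0 f (geometric M (Normc.normc c))) => [n||n].
- by rewrite /= mulr_ge0// exprn_ge0// normc_ge0.
- by apply: cvg_geometric; rewrite ger0_norm ?normc_ge0.
elim: n => [|n IHn]; first by rewrite /= expr0 mulr1.
by rewrite fE /= exprS mulrCA; apply: l2leZ; exact: Sc.
Qed.

End SquareSummable.

(** * The Neumann series and resolvents of unitary operators *)

Section Neumann.
Set Implicit Arguments.
Unset Strict Implicit.
Variables (R : realType) (m : nat).
Local Notation C := R[i].
Local Open Scope classical_set_scope.
Local Notation lseq := (lseq R m).
Implicit Types (f g h : lseq) (M N : R) (S T : lseq -> lseq).

(** Convergence in C, spelled out by real limits so that the theory of real
    series applies. *)
Definition cvgc (u : nat -> C) (l : C) :=
  complex.Re (u n) @[n --> \oo] --> complex.Re l /\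
  complex.Im (u n) @[n --> \oo] --> complex.Im l.

Lemma cvgc_nsq (u : nat -> 'cV[C]_m) (l : 'cV[C]_m) :
  (forall i, cvgc (fun n => u n i 0) (l i 0)) -> nsq (u n) @[n --> \oo] --> nsq l.
Proof.
have normcE (c : C) : Normc.normc c ^+ 2 =
    complex.Re c * complex.Re c + complex.Im c * complex.Im c.
  by case: c => a b; rewrite /= sqr_sqrtr ?addr_ge0 ?sqr_ge0// !expr2.
move=> ul; rewrite /nsq.
apply: cvg_big => [|i _]; first exact: add_continuous.
rewrite normcE; under eq_fun do rewrite normcE.
by have [re im] := ul i; apply: cvgD; apply: cvgM.
Qed.

(** Closed balls are closed under coordinatewise convergence, because each
    bound in [l2le] concerns finitely many coordinates. It plays the part of
    completeness of the space of sequences. *)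
Lemma l2le_lim (G : nat -> lseq) f M :
    (forall k i, cvgc (fun n => G n k i 0) (f k i 0)) ->
  (forall n, l2le M (G n)) -> l2le M f.
Proof.
move=> Gf GM s us.
have cv : \sum_(k <- s) nsq (G n k) @[n --> \oo] --> \sum_(k <- s) nsq (f k).
  apply: cvg_big => [|k _]; first exact: add_continuous.
  exact: cvgc_nsq.
rewrite -(cvg_lim _ cv)//; apply: limr_le.
  by apply/cvg_ex; exists (\sum_(k <- s) nsq (f k)).
by apply: nearW => n; exact: GM.
Qed.

Lemma Re_sum n (x : nat -> C) :
  complex.Re (\sum_(i < n) x i) = \sum_(i < n) complex.Re (x i).
Proof. by apply: big_morph => // -[a b] [c d]. Qed.

Lemma Im_sum n (x : nat -> C) :
  complex.Im (\sum_(i < n) x i) = \sum_(i < n) complex.Im (x i).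
Proof. by apply: big_morph => // -[a b] [c d]. Qed.

Lemma dominated_series_cvg (u : nat -> R) (K q : R) : 0 <= K -> 0 <= q < 1 ->
  (forall n, `|u n| <= K * q ^+ n) -> cvgn (series u).
Proof.
move=> K0 /andP[q0 q1] uq; apply: normed_cvg.
apply: (@series_le_cvg _ _ (geometric K q)) => [n|n|n|].
- exact: normr_ge0.
- by rewrite /= mulr_ge0// exprn_ge0.
- exact: uq.
- by apply: is_cvg_geometric_series; rewrite ger0_norm.
Qed.

Lemma geometric_cvgc (x : nat -> C) (K q : R) : 0 <= K -> 0 <= q < 1 ->
    (forall n, Normc.normc (x n) <= K * q ^+ n) ->
  exists l : C, cvgc (fun n => \sum_(i < n) x i) l.
Proof.
move=> K0 q01 xq.
have Re_le (c : C) : `|complex.Re c| <= Normc.normc c.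
  by case: c => a b; rewrite /= -sqrtr_sqr ler_wsqrtr// lerDl sqr_ge0.
have Im_le (c : C) : `|complex.Im c| <= Normc.normc c.
  by case: c => a b; rewrite /= -sqrtr_sqr ler_wsqrtr// lerDr sqr_ge0.
have cre := dominated_series_cvg K0 q01 (fun n => le_trans (Re_le (x n)) (xq n)).
have cim := dominated_series_cvg K0 q01 (fun n => le_trans (Im_le (x n)) (xq n)).
exists (lim (series (fun j => complex.Re (x j)) @ \oo) +i*
  lim (series (fun j => complex.Im (x j)) @ \oo)).
split => /=.
  under eq_fun do rewrite Re_sum -(big_mkord xpredT (fun j => complex.Re (x j))).
  exact: cre.
under eq_fun do rewrite Im_sum -(big_mkord xpredT (fun j => complex.Im (x j))).
exact: cim.
Qed.

Lemma cvgcB_shift (u : nat -> C) l (N : nat) : cvgc u l ->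
  cvgc (fun n => u (n + N)%N - u N) (l - u N).
Proof.
have ReB (c d : C) : complex.Re (c - d) = complex.Re c - complex.Re d.
  by case: c d => ? ? [].
have ImB (c d : C) : complex.Im (c - d) = complex.Im c - complex.Im d.
  by case: c d => ? ? [].
move=> [re im]; split; [rewrite ReB | rewrite ImB].
- under eq_fun do rewrite ReB.
  by apply: cvgB; [rewrite (cvg_shiftn N (fun n => complex.Re (u n))) | exact: cvg_cst].
- under eq_fun do rewrite ImB.
  by apply: cvgB; [rewrite (cvg_shiftn N (fun n => complex.Im (u n))) | exact: cvg_cst].
Qed.

(** Every coordinate of the series is dominated by a geometric series, which
    defines f. The remainder is estimated in norm, with the telescoping
    bounds T n = K q^n / (1 - q), before passing to the limit with
    [l2le_lim]. *)
Lemma l2_geometric_series (x : nat -> lseq) (K q : R) : 0 <= K -> 0 <= q < 1 ->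
    (forall n, l2le (K * q ^+ n) (x n)) ->
  exists f, forall n, l2le (K * q ^+ n / (1 - q)) (f - \sum_(i < n) x i).
Proof.
move=> K0 q01 xK; have /andP[q0 q1] := q01.
have q1' : 0 < 1 - q by rewrite subr_gt0.
have coord n k i : Normc.normc (x n k i 0) <= K * q ^+ n.
  rewrite -(@ler_pXn2r _ 2) ?nnegrE ?normc_ge0 ?mulr_ge0 ?exprn_ge0//.
  apply: le_trans (nsq_entry _ _) _.
  by have := xK n [:: k] isT; rewrite big_seq1.
have /choice[F FP] (ki : int * 'I_m) := geometric_cvgc K0 q01 (fun n => coord n ki.1 ki.2).
pose f : lseq := fun k => \col_i F (k, i).
pose g n : lseq := \sum_(i < n) x i.
pose T n := K * q ^+ n / (1 - q).
have T_ge0 n : 0 <= T n by rewrite divr_ge0 ?mulr_ge0 ?exprn_ge0// ltW.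
have TS n : T n - T n.+1 = K * q ^+ n.
  by rewrite /T exprS; field; rewrite gt_eqF.
have Tdec p n : T (p + n)%N <= T n.
  elim: p => [//|p IHp]; apply: le_trans IHp.
  by rewrite addSn -subr_ge0 TS mulr_ge0// exprn_ge0.
have gT p n : l2le (T n - T (p + n)%N) (g (p + n)%N - g n).
  elim: p => [|p IHp]; first by rewrite !subrr; exact: l2le_zero.
  have -> : T n - T (p.+1 + n)%N = (T n - T (p + n)%N) + K * q ^+ (p + n).
    by rewrite -TS addrA subrK.
  have -> : g (p.+1 + n)%N - g n = (g (p + n)%N - g n) + x (p + n)%N.
    by rewrite /g big_ord_recr /= addrAC.
  by apply: l2leD => //; rewrite ?subr_ge0 ?mulr_ge0 ?exprn_ge0.
exists f => n; apply: (@l2le_lim (fun p => g (p + n)%N - g n)) => [k i|p]; last first.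
  apply: l2le_le (gT p n); first by rewrite subr_ge0.
  by rewrite gerBl.
have gE p : g p k i 0 = \sum_(j < p) x j k i 0.
  by rewrite /g fct_sumE summxE.
have -> : (fun p => (g (p + n)%N - g n) k i 0) =
    (fun p => \sum_(j < p + n) x j k i 0 - \sum_(j < n) x j k i 0).
  by apply/funext => p; rewrite -!gE [LHS]mxE [X in _ + X]mxE.
have -> : (f - \sum_(j < n) x j) k i 0 = F (k, i) - \sum_(j < n) x j k i 0.
  by rewrite -gE [LHS]mxE [X in _ + X]mxE [X in X - _]mxE.
exact: (cvgcB_shift n (FP (k, i))).
Qed.

(** The solution is the sum of the c^n S^n h. Its defect f - c S f - h is
    rewritten with the remainders of the partial sums, hence has norm at
    most T n.+1 + q T n for T n = K q^n / (1 - q), which tends to 0. *)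
Lemma neumann S c h : is_linear S -> l2_contraction S -> Normc.normc c < 1 -> l2 h ->
  exists2 f, l2 f & f - c *: S f = h.
Proof.
move=> Sl Sc c1 /l2P[K K0 hK]; set q := Normc.normc c in c1.
have q0 : 0 <= q by exact: normc_ge0.
have q1' : 0 < 1 - q by rewrite subr_gt0.
pose x n : lseq := iter n (fun f => c *: S f) h.
have xK n : l2le (K * q ^+ n) (x n).
  elim: n => [|n IHn]; first by rewrite expr0 mulr1.
  by rewrite exprS mulrCA; apply: l2leZ; exact: Sc.
have [|f fx] := l2_geometric_series K0 _ xK; first by rewrite q0.
exists f.
  apply/l2P; exists (K * q ^+ 0 / (1 - q)); first by rewrite expr0 mulr1 divr_ge0// ltW.
  by have := fx 0%N; rewrite big_ord0 subr0.
pose T n := K * q ^+ n / (1 - q).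
have T_ge0 n : 0 <= T n by rewrite divr_ge0 ?mulr_ge0 ?exprn_ge0// ltW.
pose g n : lseq := \sum_(i < n) x i.
have gS n : g n.+1 = h + c *: S (g n).
  elim: n => [|n IHn].
    by rewrite /g big_ord_recr !big_ord0 /= (lin0 Sl) scaler0 addr0 add0r.
  have gr p : g p.+1 = g p + x p by exact: big_ord_recr.
  by rewrite [LHS]gr [in LHS]IHn [in RHS]gr (linD _ _ Sl) scalerDr addrA.
apply/eqP; rewrite -subr_eq0; apply/eqP.
apply: (@l2le_eq0 _ _ _ (fun n => T n.+1 + q * T n)) => [n||n].
- by apply: addr_ge0; [exact: T_ge0 | exact: mulr_ge0].
- have Tcvg : T n @[n --> \oo] --> 0.
    rewrite -(mul0r ((1 - q)^-1)); apply: cvgM; last exact: cvg_cst.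
    by apply: cvg_geometric; rewrite ger0_norm.
  rewrite -[0]addr0 -[X in _ + X](mulr0 q); apply: cvgD.
    by rewrite cvg_shiftS.
  by apply: cvgM => //; exact: cvg_cst.
have -> : f - c *: S f - h = (f - g n.+1) + (- c) *: S (f - g n).
  rewrite gS (linB _ _ Sl) scaleNr scalerBr opprB.
  by rewrite opprD !addrA subrK addrAC.
apply: (l2leD (T_ge0 n.+1) (mulr_ge0 q0 (T_ge0 n)) (fx n.+1)).
have -> : q = Normc.normc (- c).
  rewrite -mulN1r Normc.normcM /= oppr0 sqrrN expr0n addr0 expr1n.
  by rewrite sqrtr1 mul1r.
by apply: l2leZ; apply: Sc; exact: fx.
Qed.

(** Unitarity in the form in which it is used: an invertible linear map such
    that it and its inverse are contractions. *)
Definition l2unitary S := exists T,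
  [/\ is_linear S, is_linear T, l2_contraction S, l2_contraction T & cancel S T /\ cancel T S].

Lemma l2unitary_id : l2unitary id.
Proof. by exists id; split. Qed.

Lemma l2unitary_comp S T : l2unitary S -> l2unitary T -> l2unitary (S \o T).
Proof.
move=> [S' [Sl Sl' Sc Sc' [SK SK']]] [T' [Tl Tl' Tc Tc' [TK TK']]].
exists (T' \o S'); split.
- by move=> c f g /=; rewrite Tl Sl.
- by move=> c f g /=; rewrite Sl' Tl'.
- by move=> M f fM /=; exact/Sc/Tc.
- by move=> M f fM /=; exact/Tc'/Sc'.
- by split; [exact: can_comp | exact: can_comp].
Qed.

Lemma normc_mulV (z : C) : z != 0 -> Normc.normc z * Normc.normc z^-1 = 1.
Proof. by move=> z0; rewrite -Normc.normcM mulfV// Normc.normc1. Qed.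

(** The equation is f - z S^-1 f = S^-1 g, or f - z^-1 S f = - z^-1 g; the
    Neumann series solves the first for |z| < 1 and the second for |z| > 1. *)
Lemma unitary_resolvent S z g : l2unitary S -> Normc.normc z != 1 -> l2 g ->
  exists2 f, l2 f & S f - z *: f = g.
Proof.
move=> [S' [Sl Sl' Sc Sc' [SK SK']]] z1 lg.
have [z_lt1|z_gt1|/eqP] := ltgtP (Normc.normc z) 1; last by rewrite (negPf z1).
  have [f lf fE] := neumann Sl' Sc' z_lt1 (contr_l2 Sc' lg).
  exists f => //; apply: (can_inj SK'); rewrite (linB _ _ Sl') SK.
  by rewrite (linZ _ _ Sl').
have z0 : z != 0 by apply: contraTneq z_gt1 => ->; rewrite Normc.normc0 -leNgt.
have zV : Normc.normc z^-1 < 1.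
  have := normc_mulV z0; move: (Normc.normc z) (Normc.normc _) z_gt1 (normc_ge0 z^-1).
  move=> a b; nra.
have [f lf fE] := neumann Sl Sc zV (l2Z (- z^-1) lg).
exists f => //; have zg : z *: (- z^-1 *: g) = - g.
  by rewrite scaleNr scalerN scalerA mulfV// scale1r.
by rewrite -[RHS]opprK -zg -fE scalerBr scalerA mulfV// scale1r opprB.
Qed.

Lemma unitary_resolvent_uniq S z f : l2unitary S -> Normc.normc z != 1 -> l2 f ->
  S f - z *: f = 0 -> f = 0.
Proof.
move=> [S' [Sl Sl' Sc Sc' [SK SK']]] z1 lf /eqP; rewrite subr_eq0 => /eqP SE.
have [z_lt1|z_gt1|/eqP] := ltgtP (Normc.normc z) 1; last by rewrite (negPf z1).
  by apply: (fixpoint_eq0 Sc' z_lt1 lf); rewrite -(linZ _ _ Sl') -SE SK.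
have z0 : z != 0 by apply: contraTneq z_gt1 => ->; rewrite Normc.normc0 -leNgt.
have zV : Normc.normc z^-1 < 1.
  have := normc_mulV z0; move: (Normc.normc z) (Normc.normc _) z_gt1 (normc_ge0 z^-1).
  move=> a b; nra.
by apply: (fixpoint_eq0 Sc zV lf); rewrite SE scalerA mulVf// scale1r.
Qed.

Lemma resolventP S z g : l2unitary S -> Normc.normc z != 1 -> l2 g ->
  l2 (resolvent S z g) /\ S (resolvent S z g) - z *: resolvent S z g = g.
Proof.
move=> Su z1 lg; have [f lf fE] := unitary_resolvent Su z1 lg.
by apply: (@xgetPex _ 0 [set f | l2 f /\ S f - z *: f = g]); exists f.
Qed.

Lemma resolvent_uniq S z f : l2unitary S -> Normc.normc z != 1 -> l2 f ->
  resolvent S z (S f - z *: f) = f.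
Proof.
move=> Su z1 lf; have [S' [Sl Sl' Sc Sc' [SK SK']]] := Su.
have lg : l2 (S f - z *: f) by apply: l2B; [exact: contr_l2 | exact: l2Z].
have [lr rE] := resolventP Su z1 lg.
apply/eqP; rewrite -subr_eq0; apply/eqP.
apply: (unitary_resolvent_uniq Su z1); first exact: l2B.
rewrite (linB _ _ Sl) scalerBr opprB [X in _ + X]addrC addrACA rE.
by rewrite [X in _ + X]addrC -[z *: f - _]opprB subrr.
Qed.

End Neumann.

(** * Rank of an operator that factors through a matrix *)

Section RankOfFactorization.
Set Implicit Arguments.
Unset Strict Implicit.
Variables (R : realType) (m : nat).
Local Notation C := R[i].
Local Notation lseq := (lseq R m).
Local Open Scope classical_set_scope.

(** n + 1 vectors in the span of n vectors are given by a matrix with n + 1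
    rows and n columns, which has a nonzero kernel. *)
Lemma rank_eq_gt_absurd (T : lseq -> lseq) n : rank_eq T n -> ~ rank_gt T n.
Proof.
move=> [v [_ _ vgen]] [w [wT windep]].
have /choice[c cE] (i : 'I_n.+1) := vgen (w i) (wT i).
pose A : 'M[C]_(n.+1, n) := \matrix_(i, j) c i j.
have /rowV0Pn[x /sub_kermxP xA x0] : kermx A != 0.
  rewrite kermx_eq0 /row_free; apply/negP => /eqP rA.
  by have := rank_leq_col A; rewrite rA ltnn.
have xw : \sum_i x 0 i *: w i = 0.
  rewrite (eq_bigr (fun i => \sum_j (x 0 i * c i j) *: v j)) => [|i _].
    rewrite exchange_big big1//= => j _; rewrite -scaler_suml.
    have /matrixP/(_ 0 j) := xA; rewrite mxE [in RHS]mxE.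
    by under eq_bigr do rewrite mxE; move=> ->; rewrite scale0r.
  by rewrite cE scaler_sumr; apply: eq_bigr => j _; rewrite scalerA.
by move/eqP: x0; apply; apply/rowP => i; rewrite mxE; exact: (windep _ xw).
Qed.

Variables (T : lseq -> lseq) (d : nat) (E : 'M[C]_d).
Variables (P : lseq -> 'cV[C]_d) (J : 'cV[C]_d -> lseq).
Hypothesis TE : forall f, l2 f -> T f = J (E *m P f).
Hypothesis P_surj : forall w, exists2 f, l2 f & P f = w.
Hypothesis J_lin : forall c x y, J (c *: x + y) = c *: J x + J y.
Hypothesis J_inj : forall x, J x = 0 -> x = 0.

Let J0 : J 0 = 0.
Proof.
by have := J_lin (-1) 0 0; rewrite scaler0 addr0 scaleN1r addNr.
Qed.

Let J_sum n (c : 'I_n -> C) (x : 'I_n -> 'cV[C]_d) :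
  J (\sum_i c i *: x i) = \sum_i c i *: J (x i).
Proof.
elim: n c x => [|n IHn] c x; first by rewrite !big_ord0 J0.
by rewrite !big_ord_recl J_lin IHn.
Qed.

Let J_range w : (T @` @l2 R m) (J (E *m w)).
Proof. by have [f lf <-] := P_surj w; exists f => //; exact: TE. Qed.

Let basis (i : 'I_(\rank E)) : lseq := J (col i (col_base E)).

Let sum_col n (c : 'I_n -> C) (A : 'M[C]_(d, n)) :
  \sum_i c i *: col i A = A *m \col_i c i.
Proof.
apply/colP => j; rewrite summxE !mxE; apply: eq_bigr => i _.
by rewrite !mxE mulrC.
Qed.

Let basis_range i : (T @` @l2 R m) (basis i).
Proof.
have [G' GG] := row_freeP (row_base_free E).
have -> : basis i = J (E *m (G' *m delta_mx i 0)); last exact: J_range.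
rewrite -[X in X *m (G' *m _)](mulmx_base E).
by rewrite -mulmxA [row_base E *m _]mulmxA GG mul1mx -colE.
Qed.

Let basis_indep : lin_indep basis.
Proof.
move=> c; rewrite -J_sum sum_col => /J_inj cE0 i.
have [F' FF] := row_fullP (col_base_full E).
have /colP/(_ i) := congr1 (mulmx F') cE0.
by rewrite mulmxA FF mul1mx mulmx0 !mxE.
Qed.

(** As P is onto and J injective, the range of T is the image by J of the
    column space of E. *)
Lemma rank_eq_factor : rank_eq T (\rank E).
Proof.
exists basis; split=> [i||g [f lf <-]]; [exact: basis_range | exact: basis_indep|].
exists (fun i => (row_base E *m P f) i 0); rewrite -J_sum sum_col TE//.
rewrite -[X in X *m P f](mulmx_base E) -mulmxA; congr (J (_ *m _)).
by apply/colP => i; rewrite [RHS]mxE.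
Qed.

Lemma rank_gt_factor n : (n < \rank E)%N -> rank_gt T n.
Proof.
move=> nE; exists (fun i => basis (widen_ord nE i)); split=> [i|c csum i].
  exact: basis_range.
pose c' (j : 'I_(\rank E)) := if insub (val j) is Some i then c i else 0.
have c'E j : c' (widen_ord nE j) = c j.
  by rewrite /c'; case: insubP => [k _ /val_inj->//|/=]; rewrite ltn_ord.
rewrite -c'E; apply: basis_indep.
rewrite (bigID (fun j : 'I_(\rank E) => (j < n.+1)%N)) /= [X in _ + X]big1.
  rewrite addr0 (big_ord_narrow nE) -[RHS]csum.
  by apply: eq_bigr => j _; rewrite c'E.
by move=> j jn; rewrite /c' insubN// scale0r.
Qed.

End RankOfFactorization.

(** * Block diagonal operators *)

Section Blocks.
Set Implicit Arguments.
Unset Strict Implicit.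
Variables (R : realType) (m : nat).
Local Notation C := R[i].
Local Notation lseq := (lseq R m).
Implicit Types (p : pred int) (B : int -> 'M[C]_(m + m)) (f g : lseq).

(** The predicates that select one parity class; they are the ones for which
    the blocks at (k - 1, k), p k, tile the lattice. *)
Definition alternating_pred p := forall k, p (k + 1) = ~~ p k.

Definition blockv (k : int) f : 'cV[C]_(m + m) := col_mx (f (k - 1)) (f k).

Lemma blockv_lin k c f g : blockv k (c *: f + g) = c *: blockv k f + blockv k g.
Proof. by rewrite /blockv scale_col_mx add_col_mx. Qed.

Lemma mul_block_col2 (A : 'M[C]_(m + m)) (x y : 'cV[C]_m) :
  A *m col_mx x y = col_mx (ulsubmx A *m x + ursubmx A *m y)
                           (dlsubmx A *m x + drsubmx A *m y).
Proof. by rewrite -{1}(submxK A) mul_block_col. Qed.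

Lemma blockdiag_blockv p B f k : alternating_pred p -> p k ->
  blockv k (blockdiag p B f) = B k *m blockv k f.
Proof.
move=> alt pk; rewrite /blockv mul_block_col2 /blockdiag pk.
have -> : p (k - 1) = false by have := alt (k - 1); rewrite subrK pk; case: (p _).
by rewrite subrK.
Qed.

Lemma blockv_ext p f g : alternating_pred p ->
  (forall k, p k -> blockv k f = blockv k g) -> f = g.
Proof.
move=> alt fg; apply/funext => k; have [pk|pk] := boolP (p k).
  by have /eq_col_mx[] := fg k pk.
have pk1 : p (k + 1) by rewrite alt.
by have /eq_col_mx[] := fg _ pk1; rewrite addrK.
Qed.

Lemma blockdiagK p B B' : alternating_pred p -> (forall k, B' k *m B k = 1%:M) ->
  cancel (blockdiag p B) (blockdiag p B').
Proof.
move=> alt BB f; apply: (blockv_ext alt) => k pk.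
by rewrite !blockdiag_blockv// mulmxA BB mul1mx.
Qed.

Lemma blockdiag_lin p B : is_linear (blockdiag p B).
Proof.
move=> c f g; apply/funext => k; rewrite /blockdiag /=.
change (blockdiag p B (c *: f + g) k = c *: blockdiag p B f k + blockdiag p B g k).
rewrite /blockdiag; case: ifP => _.
  change ((c *: f + g) (k - 1)) with (c *: f (k - 1) + g (k - 1)).
  change ((c *: f + g) k) with (c *: f k + g k).
  by rewrite !mulmxDr -!scalemxAr scalerDr addrACA.
change ((c *: f + g) (k + 1)) with (c *: f (k + 1) + g (k + 1)).
change ((c *: f + g) k) with (c *: f k + g k).
by rewrite !mulmxDr -!scalemxAr scalerDr addrACA.
Qed.

Lemma ler_sum_subset (s t : seq int) (F : int -> R) : uniq s -> uniq t ->
  {subset s <= t} -> (forall j, 0 <= F j) ->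
  \sum_(j <- s) F j <= \sum_(j <- t) F j.
Proof.
move=> us ut st F0; rewrite [leRHS](bigID (mem s)) /= -[X in _ <= X + _]big_filter.
rewrite (perm_big [seq j <- t | j \in s]) ?lerDl ?sumr_ge0//=.
apply: uniq_perm => //; first exact: filter_uniq.
by move=> j; rewrite mem_filter; case: (boolP (j \in s)) => // /st ->.
Qed.

(** No two blocks overlap, since p selects every other integer. *)
Lemma uniq_blocks p (u : seq int) : alternating_pred p ->
  (forall k, k \in u -> p k) -> uniq u ->
  uniq (flatten [seq [:: k - 1; k] | k <- u]).
Proof.
move=> alt; elim: u => [//|k u IHu] pu /= /andP[ku uu].
have pk : p k by apply: pu; rewrite mem_head.
have pk1 : p (k - 1) = false by have := alt (k - 1); rewrite subrK pk; case: (p _).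
have {}IHu : uniq (flatten [seq [:: k0 - 1; k0] | k0 <- u]).
  by apply: IHu => // j ju; apply: pu; rewrite inE ju orbT.
rewrite IHu andbT inE negb_or; apply/andP; split.
  apply/andP; split; first by lia.
  apply/flatten_mapP => -[j ju]; rewrite !inE => /orP[/eqP/addIr kj|/eqP kj].
    by rewrite kj ju in ku.
  by rewrite kj pu ?inE ?ju ?orbT in pk1.
apply/flatten_mapP => -[j ju]; rewrite !inE => /orP[/eqP kj|/eqP kj].
  have := alt (j - 1); rewrite subrK -kj pk pu//.
  by rewrite inE ju orbT.
by rewrite kj ju in ku.
Qed.

(** The sum over a finite set is enlarged to a union of whole blocks, on each
    of which the operator preserves the sum of squares. *)
Lemma blockdiag_contr p B : alternating_pred p ->
  (forall k, (B k)^t* *m B k = 1%:M) -> l2_contraction (blockdiag p B).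
Proof.
move=> alt BB M f fM s us.
(* the index of the block that contains the coordinate j *)
pose blk j := if p j then j else j + 1.
have pblk j : p (blk j) by rewrite /blk; case: ifP => // pj; rewrite alt pj.
pose u := undup (map blk s).
have pu k : k \in u -> p k by rewrite mem_undup => /mapP[j _ ->].
pose t := flatten [seq [:: k - 1; k] | k <- u].
have sum_t (F : int -> R) : \sum_(j <- t) F j = \sum_(k <- u) (F (k - 1) + F k).
  rewrite big_flatten big_map; apply: eq_bigr => k _.
  by rewrite big_cons big_seq1.
have ut : uniq t by apply: (uniq_blocks alt pu); exact: undup_uniq.
have st : {subset s <= t}.
  move=> j js; apply/flatten_mapP; exists (blk j).
    by rewrite mem_undup map_f.
  by rewrite !inE /blk; case: ifP => _; rewrite ?eqxx ?orbT ?addrK ?eqxx.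
have le_st : \sum_(j <- s) nsq (blockdiag p B f j)
    <= \sum_(j <- t) nsq (blockdiag p B f j).
  by apply: ler_sum_subset => // j; exact: nsq_ge0.
apply: le_trans le_st _; apply: le_trans (fM t ut); rewrite !sum_t.
rewrite !big_seq; apply: ler_sum => k /pu pk.
rewrite -!nsq_col_mx -/(blockv k _) -/(blockv k f) blockdiag_blockv//.
by rewrite nsq_isometry.
Qed.

Lemma blockdiag_unitary p B : alternating_pred p ->
  (forall k, (B k)^t* *m B k = 1%:M) -> l2unitary (blockdiag p B).
Proof.
move=> alt BB; have BB' k : B k *m (B k)^t* = 1%:M by exact: mulmx1C.
exists (blockdiag p (fun k => (B k)^t*)); split.
- exact: blockdiag_lin.
- exact: blockdiag_lin.
- exact: blockdiag_contr.
- by apply: blockdiag_contr => // k; rewrite trmxCK.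
- by split; apply: blockdiagK.
Qed.

(** A right inverse of [blockv k]. *)
Definition embed (k : int) (w : 'cV[C]_(m + m)) : lseq := fun j =>
  if j == k - 1 then usubmx w else if j == k then dsubmx w else 0.

Lemma embed_lin k c x y : embed k (c *: x + y) = c *: embed k x + embed k y.
Proof.
apply/funext => j.
change (embed k (c *: x + y) j = c *: embed k x j + embed k y j).
rewrite /embed; case: ifP => _; first by rewrite linearP.
case: ifP => _; first by rewrite linearP.
by rewrite scaler0 addr0.
Qed.

Lemma blockv_embed k w : blockv k (embed k w) = w.
Proof.
rewrite /blockv /embed !eqxx.
have -> : (k == k - 1) = false by lia.
exact: vsubmxK.
Qed.

Lemma blockv_embed_neq k0 k w : k != k0 -> k != k0 - 1 -> k != k0 + 1 ->
  blockv k (embed k0 w) = 0.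
Proof.
move=> h1 h2 h3; rewrite /blockv /embed.
have -> : (k - 1 == k0 - 1) = false by lia.
have -> : (k - 1 == k0) = false by lia.
by rewrite (negPf h1) (negPf h2) col_mx0.
Qed.

Lemma l2_embed k w : l2 (embed k w).
Proof.
apply/l2P; exists (1 + nsq w); first by rewrite addr_ge0 ?nsq_ge0.
move=> s us; apply: (@le_trans _ _ (nsq w)); last first.
  have := nsq_ge0 w; move: (nsq w) => a; nra.
set t := [:: k - 1; k].
have le_t : \sum_(j <- s) nsq (embed k w j) <= \sum_(j <- undup (s ++ t)) nsq (embed k w j).
  apply: ler_sum_subset => // [|j js|j]; [exact: undup_uniq| |exact: nsq_ge0].
  by rewrite mem_undup mem_cat js.
apply: le_trans le_t _.
have ut : uniq t by rewrite /= inE andbT; lia.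
rewrite (bigID (fun j => j \in t)) /= [X in _ + X]big1 => [|j]; last first.
  by rewrite !inE negb_or /embed => /andP[/negPf-> /negPf->]; rewrite nsq0.
rewrite addr0 -big_filter (perm_big t).
  rewrite big_cons big_seq1 /embed !eqxx.
  have -> : (k == k - 1) = false by lia.
  by rewrite /= -nsq_col_mx vsubmxK.
apply: uniq_perm => //; first by rewrite filter_uniq ?undup_uniq.
move=> j; rewrite mem_filter mem_undup mem_cat.
by case: (j \in t); rewrite ?orbT.
Qed.

(** Evaluate on the blocks: only the one at k0 distinguishes the operators. *)
Lemma blockdiag_diff p B B' k0 f : alternating_pred p -> p k0 ->
    (forall k, k != k0 -> B k = B' k) ->
  blockdiag p B f - blockdiag p B' f
  = embed k0 ((B k0 - B' k0) *m blockv k0 f).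
Proof.
move=> alt pk0 BB'; apply: (blockv_ext alt) => k pk.
rewrite -scaleN1r addrC blockv_lin !blockdiag_blockv// scaleN1r addrC -mulmxBl.
have [->|kk0] := eqVneq k k0; first by rewrite blockv_embed.
rewrite BB'// subrr mul0mx blockv_embed_neq//.
  by apply: contraTneq pk => ->; have := alt (k0 - 1); rewrite subrK pk0; case: (p _).
by apply: contraTneq pk => ->; rewrite alt pk0.
Qed.

Lemma blockdiag_eq p B B' k0 : ~~ p k0 -> alternating_pred p ->
  (forall k, k != k0 -> B k = B' k) -> blockdiag p B = blockdiag p B'.
Proof.
move=> pk0 alt BB'; apply/funext => f; apply: (blockv_ext alt) => k pk.
by rewrite !blockdiag_blockv// BB'//; apply: contraNneq pk0 => <-.
Qed.

Lemma even_alternating : alternating_pred evenz.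
Proof. by move=> k; rewrite /evenz; lia. Qed.

Lemma odd_alternating : alternating_pred (fun k => ~~ evenz k).
Proof. by move=> k; rewrite even_alternating. Qed.

(** The shape shared by all the operators in play: the even blocks of B act
    after its odd blocks. *)
Definition layers B : lseq -> lseq :=
  blockdiag evenz B \o blockdiag (fun k => ~~ evenz k) B.

Lemma layers_unitary B : (forall k, (B k)^t* *m B k = 1%:M) -> l2unitary (layers B).
Proof.
move=> BB; apply: l2unitary_comp; apply: blockdiag_unitary => //.
  exact: even_alternating.
exact: odd_alternating.
Qed.

(** The block at k0 belongs to one of the two layers. If it is the even one,
    the common odd layer factors out on the right; if it is the odd one, the
    common even layer factors out on the left. *)
Lemma layers_diff B B' k0 : (forall k, (B k)^t* *m B k = 1%:M) ->
    (forall k, k != k0 -> B k = B' k) ->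
  exists L Q, [/\ l2unitary L, l2unitary Q &
    forall f, layers B f - layers B' f =
      L (embed k0 ((B k0 - B' k0) *m blockv k0 (Q f)))].
Proof.
move=> BB BB'; have [ek0|ok0] := boolP (evenz k0).
  exists id, (blockdiag (fun k => ~~ evenz k) B); split.
  - exact: l2unitary_id.
  - by apply: blockdiag_unitary => //; exact: odd_alternating.
  move=> f; rewrite /layers /= -(@blockdiag_eq (fun k => ~~ evenz k) B B' k0)//.
  - by apply: blockdiag_diff => //; exact: even_alternating.
  - by rewrite ek0.
  - exact: odd_alternating.
exists (blockdiag evenz B), id; split.
- by apply: blockdiag_unitary => //; exact: even_alternating.
- exact: l2unitary_id.
move=> f; rewrite /layers /= -(@blockdiag_eq evenz B B' k0)//; last first.
  exact: even_alternating.
rewrite -(linB _ _ (blockdiag_lin evenz B)); congr (blockdiag _ _ _).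
by apply: blockdiag_diff => //; exact: odd_alternating.
Qed.

End Blocks.

(** * Differences of operators and of resolvents *)

Section RankOfDifferences.
Set Implicit Arguments.
Unset Strict Implicit.
Variables (R : realType) (m : nat).
Local Notation C := R[i].
Local Notation lseq := (lseq R m).
Implicit Types (f g : lseq).

Lemma embed_eq0 k (w : 'cV[C]_(m + m)) : embed k w = 0 -> w = 0.
Proof.
by move=> /(congr1 (blockv k)); rewrite blockv_embed => ->; exact: col_mx0.
Qed.

(** The data needed to read the rank off the middle matrix in [layers_diff]. *)
Lemma l2unitary_embed_blockv (L Q : lseq -> lseq) k0 : l2unitary L -> l2unitary Q ->
  [/\ forall w, exists2 f, l2 f & blockv k0 (Q f) = w,
      forall w, l2 (L (embed k0 w)),
      forall c x y, L (embed k0 (c *: x + y)) =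
                    c *: L (embed k0 x) + L (embed k0 y)
    & forall w, L (embed k0 w) = 0 -> w = 0].
Proof.
move=> [L' [Ll Ll' Lc Lc' [LK LK']]] [Q' [Ql Ql' Qc Qc' [QK QK']]]; split.
- move=> w; exists (Q' (embed k0 w)); first exact/contr_l2/l2_embed.
  by rewrite QK' blockv_embed.
- by move=> w; exact/contr_l2/l2_embed.
- by move=> c x y; rewrite embed_lin Ll.
- move=> w Lw; apply: (@embed_eq0 k0).
  by rewrite -[LHS]LK Lw (lin0 Ll').
Qed.

(** The algebra behind the second resolvent identity. For r and r' the
    resolvents of U and U' at the same vector, it is used with x = U r, y =
    U r', y' = U' r', w = z r and w' = z r'. *)
Lemma resolvent_identity (V : zmodType) (x y y' w w' : V) :
  x - w = y' - w' -> x - y - (w - w') = - (y - y').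
Proof.
by move=> xw; rewrite opprD addrACA -opprD xw [- (y - w')]opprB addrA subrK opprB.
Qed.

Variables (B B' : int -> 'M[C]_(m + m)) (k0 : int).
Hypothesis BU : forall k, (B k)^t* *m B k = 1%:M.
Hypothesis BB' : forall k, k != k0 -> B k = B' k.
Let E := B k0 - B' k0.

Lemma rank_layers_diff :
  rank_eq (layers B \- layers B') (\rank E) /\
  (forall n, (n < \rank E)%N -> rank_gt (layers B \- layers B') n).
Proof.
have [L [Q [Lu Qu DE]]] := layers_diff BU BB'.
have [surj Ll2 Jlin Jinj] := l2unitary_embed_blockv k0 Lu Qu.
have DE' f : l2 f -> (layers B \- layers B') f = L (embed k0 (E *m blockv k0 (Q f))).
  by move=> _; exact: DE.
split; first exact: (rank_eq_factor DE' surj Jlin Jinj).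
exact: (rank_gt_factor DE' surj Jlin Jinj).
Qed.

Lemma resolvent_lin (S : lseq -> lseq) z c f g : l2unitary S ->
  Normc.normc z != 1 -> l2 f -> l2 g ->
  resolvent S z (c *: f + g) = c *: resolvent S z f + resolvent S z g.
Proof.
move=> Su z1 lf lg; have [S' [Sl _ _ _ _]] := Su.
have [lrf rfE] := resolventP Su z1 lf; have [lrg rgE] := resolventP Su z1 lg.
rewrite -[RHS](resolvent_uniq Su z1); last by apply: l2D => //; exact: l2Z.
congr (resolvent _ _ _).
rewrite Sl -{1}rfE -{1}rgE.
rewrite [in RHS]scalerDr opprD [RHS]addrACA scalerBr.
by rewrite !scalerA [z * c]mulrC.
Qed.

Hypothesis BU' : forall k, (B' k)^t* *m B' k = 1%:M.

(** Write U and U' for the operators with blocks B and B'. By the second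
    resolvent identity the difference of their resolvents is - (U - z)^-1 (U
    - U') (U' - z)^-1, so that U - U' is only composed with bijections of
    the square-summable sequences; the matrix in the middle is unchanged. *)
Lemma rank_resolvent_diff z : Normc.normc z != 1 ->
  let T := resolvent (layers B) z \- resolvent (layers B') z in
  rank_eq T (\rank E) /\ (forall n, (n < \rank E)%N -> rank_gt T n).
Proof.
move=> z1 T; have [L [Q [Lu Qu DE]]] := layers_diff BU BB'.
have [surj Ll2 Jlin Jinj] := l2unitary_embed_blockv k0 Lu Qu.
have Uu := layers_unitary BU; have Uu' := layers_unitary BU'.
have [_ [Ul _ _ _ _]] := Uu; have [_ [Ul' _ Uc' _ _]] := Uu'.
pose RU := resolvent (layers B) z; pose RU' := resolvent (layers B') z.
pose J w := RU (L (embed k0 (- w))).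
have L0 : L (embed k0 0) = 0.
  by have := Jlin (-1) 0 0; rewrite scaler0 addr0 scaleN1r addNr.
have LN w : L (embed k0 (- w)) = - L (embed k0 w).
  by have := Jlin (-1) w 0; rewrite !scaleN1r L0 !addr0.
have JlinN c x y : L (embed k0 (- (c *: x + y))) =
    c *: L (embed k0 (- x)) + L (embed k0 (- y)).
  by rewrite opprD -scalerN Jlin.
have TE g : l2 g -> T g = J (E *m blockv k0 (Q (RU' g))).
  move=> lg.
  have [lr rE] : l2 (RU g) /\ layers B (RU g) - z *: RU g = g := resolventP Uu z1 lg.
  have [lr' rE'] : l2 (RU' g) /\ layers B' (RU' g) - z *: RU' g = g :=
    resolventP Uu' z1 lg.
  change (RU g - RU' g = J (E *m blockv k0 (Q (RU' g)))).
  move: (RU g) (RU' g) lr rE lr' rE' => r r' lr rE lr' rE'.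
  rewrite -[LHS](resolvent_uniq Uu z1); last exact: l2B.
  rewrite /J LN -DE; congr (RU _); rewrite (linB _ _ Ul) scalerBr.
  by apply: resolvent_identity; rewrite rE rE'.
have surj' w : exists2 g, l2 g & blockv k0 (Q (RU' g)) = w.
  have [f lf fw] := surj w; exists (layers B' f - z *: f).
    by apply: l2B; [exact: contr_l2 | exact: l2Z].
  by rewrite /RU' resolvent_uniq.
have Jlin' c x y : J (c *: x + y) = c *: J x + J y.
  by rewrite /J JlinN; exact: resolvent_lin.
have Jinj' w : J w = 0 -> w = 0.
  have [_] : l2 (J w) /\ layers B (J w) - z *: J w = L (embed k0 (- w)) :=
    resolventP Uu z1 (Ll2 (- w)).
  move=> JE Jw; move: JE; rewrite Jw (lin0 Ul) scaler0 subrr => /esym/Jinj/eqP.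
  by rewrite oppr_eq0 => /eqP.
split; first exact: (rank_eq_factor TE surj' Jlin' Jinj').
exact: (rank_gt_factor TE surj' Jlin' Jinj').
Qed.

End RankOfDifferences.

(** * The decoupled operator *)

Section Decoupling.
Set Implicit Arguments.
Unset Strict Implicit.
Variables (R : realType) (m : nat).
Local Notation C := R[i].
Local Notation lseq := (lseq R m).
Implicit Types (f : lseq) (g : 'M[C]_m) (B : int -> 'M[C]_(m + m)).

Lemma decoupled_isometry g1 g2 : g1 \is unitarymx -> g2 \is unitarymx ->
  (decoupled g1 g2)^t* *m decoupled g1 g2 = 1%:M.
Proof.
move=> /unitarymxP/mulmx1C g1K /unitarymxP g2VK.
rewrite /decoupled adj_block mulmx_block trmxCK adj_opp.
rewrite trmx0 map_mx0 !(mulmx0, mul0mx, addr0, add0r) mulNmx mulmxN opprK.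
by rewrite g1K g2VK -scalar_mx_block.
Qed.

Lemma phasemx_unitary (t : 'I_m -> R) : phasemx t \is unitarymx.
Proof.
apply/unitarymxP; rewrite /phasemx adj_diag mulmx_diag -diag_const_mx.
by congr diag_mx; apply/rowP => j; rewrite !mxE expi_mul_conj.
Qed.

Lemma cutl_blockdiag_eq p B B' k0 f : (forall k, k != k0 -> B k = B' k) ->
  ulsubmx (B k0) = ulsubmx (B' k0) -> ursubmx (B k0) = ursubmx (B' k0) ->
  cutl k0 (blockdiag p B f) = cutl k0 (blockdiag p B' f).
Proof.
move=> BB' ul ur; apply/funext => j; rewrite /cutl /blockdiag.
case: ifP => [jk|_]; last by [].
case: ifP => _.
  by have /BB'-> : j != k0 by move: jk; clear; lia.
by have [->|jk0] := eqVneq (j + 1) k0; [rewrite ul ur | rewrite BB'].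
Qed.

Lemma cutr_blockdiag_eq p B B' k0 f : (forall k, k != k0 -> B k = B' k) ->
  dlsubmx (B k0) = dlsubmx (B' k0) -> drsubmx (B k0) = drsubmx (B' k0) ->
  cutr k0 (blockdiag p B f) = cutr k0 (blockdiag p B' f).
Proof.
move=> BB' dl dr; apply/funext => j; rewrite /cutr /blockdiag.
case: ifP => [jk|_]; last by [].
case: ifP => _; last first.
  by have /BB'-> : j + 1 != k0 by move: jk; clear; lia.
by have [->|jk0] := eqVneq j k0; [rewrite dl dr | rewrite BB'].
Qed.

Lemma cutlK k0 f : cutl k0 (cutl k0 f) = cutl k0 f.
Proof. by apply/funext => j; rewrite /cutl; case: (j <= _). Qed.

Lemma cutrK k0 f : cutr k0 (cutr k0 f) = cutr k0 f.
Proof. by apply/funext => j; rewrite /cutr; case: (_ <= j). Qed.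

Lemma cutlDr k0 f : cutl k0 f + cutr k0 f = f.
Proof.
apply/funext => j; change (cutl k0 f j + cutr k0 f j = f j); rewrite /cutl /cutr.
have -> : (k0 <= j) = ~~ (j <= k0 - 1) by lia.
by case: (j <= k0 - 1); rewrite /= ?addr0 ?add0r.
Qed.

Definition decouple_at (alpha : int -> 'M[C]_m) k0 g1 g2 (k : int) :=
  if k == k0 then decoupled g1 g2 else Theta (alpha k).

(** A decoupled block has no entries across the cut at k0, so the cuts
    commute with both layers, and each half of the lattice only sees its own
    corner of the block. *)
Lemma cmvUgg_layers alpha k0 g1 g2 : g1 \is unitarymx -> g2 \is unitarymx ->
  cmvUgg alpha k0 g1 g2 = layers (decouple_at alpha k0 g1 g2).
Proof.
move=> g1U g2U; apply/funext => f; set B := decouple_at _ _ _ _.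
pose B1 k := Theta (replace alpha k0 g1 k).
pose B2 k := Theta (replace alpha k0 g2 k).
have Bk : B k0 = decoupled g1 g2 by rewrite /B /decouple_at eqxx.
have B1k : B1 k0 = decoupled g1 g1 by rewrite /B1 /replace eqxx Theta_unitary.
have B2k : B2 k0 = decoupled g2 g2 by rewrite /B2 /replace eqxx Theta_unitary.
have B1B k : k != k0 -> B1 k = B k.
  by move=> /negPf k_neq; rewrite /B1 /B /replace /decouple_at k_neq.
have B2B k : k != k0 -> B2 k = B k.
  by move=> /negPf k_neq; rewrite /B2 /B /replace /decouple_at k_neq.
have cut p (D : int -> 'M[C]_(m + m)) d1 d2 (h : lseq) : D k0 = decoupled d1 d2 ->
    blockdiag p D (cutl k0 h) = cutl k0 (blockdiag p D h) /\
    blockdiag p D (cutr k0 h) = cutr k0 (blockdiag p D h).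
  by move=> Dk; apply: blockdiag_cut; rewrite Dk ?block_mxKur ?block_mxKdl.
have eql p h : cutl k0 (blockdiag p B1 h) = cutl k0 (blockdiag p B h).
  by apply: cutl_blockdiag_eq => //; rewrite B1k Bk ?block_mxKul ?block_mxKur.
have eqr p h : cutr k0 (blockdiag p B2 h) = cutr k0 (blockdiag p B h).
  by apply: cutr_blockdiag_eq => //; rewrite B2k Bk ?block_mxKdl ?block_mxKdr.
have left_part : cmvUgl alpha k0 g1 f = cutl k0 (layers B f).
  change (cutl k0 (layers B1 (cutl k0 f)) = cutl k0 (layers B f)).
  by rewrite /layers /= (cut _ _ _ _ _ B1k).1 !eql (cut _ _ _ _ _ Bk).1 cutlK.
have right_part : cmvUgr alpha k0 g2 f = cutr k0 (layers B f).
  change (cutr k0 (layers B2 (cutr k0 f)) = cutr k0 (layers B f)).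
  by rewrite /layers /= (cut _ _ _ _ _ B2k).2 !eqr (cut _ _ _ _ _ Bk).2 cutrK.
by rewrite /cmvUgg left_part right_part cutlDr.
Qed.

End Decoupling.

Theorem theorem3p6 (R : realType) (m : nat) (m_gt0 : (0 < m)%N)
    (alpha : int -> 'M[R[i]]_m) (alpha_lt1 : forall k, opnorm (alpha k) < 1)
    (k0 : int) (sigma tau : 'M[R[i]]_m) (beta : 'I_m -> R[i])
    (sigmaU : sigma \is unitarymx) (tauU : tau \is unitarymx)
    (alpha_k0 : alpha k0 = sigma *m diag_mx (\row_j beta j) *m tau^t*)
    (t s : 'I_m -> R) (z : R[i]) (z_neq1 : `|z| != 1) :
  let gamma1 := sigma *m phasemx t *m tau^t* in
  let gamma2 := sigma *m phasemx s *m tau^t* in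
  let U := cmvU alpha in
  let U12 := cmvUgg alpha k0 gamma1 gamma2 in
  let D := U \- U12 in
  let Dres := resolvent U z \- resolvent U12 z in
  let angles := forall j : 'I_m, exists n : int,
    t j = 2 * carg ('i%C * (beta j * expi (- s j / 2) - expi (s j / 2)))
          + n%:~R * (2 * pi) in
  [/\ forall gamma : 'M[R[i]]_m, gamma \is unitarymx ->
        rank_gt (U \- cmvUg alpha k0 gamma) m,
      rank_eq D m <-> angles,
      rank_eq Dres m <-> angles
    & ~ angles -> rank_gt D m /\ rank_gt Dres m].
Proof.
move=> gamma1 gamma2 U U12 D Dres angles.
have zn1 : Normc.normc z != 1.
  by apply: contra z_neq1 => /eqP z1; apply/eqP; rewrite -[RHS]/(1%:C) -z1.
have phaseU (v : 'I_m -> R) : sigma *m phasemx v *m tau^t* \is unitarymx.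
  apply: mul_unitarymx; last by rewrite trmxC_unitary.
  by apply: (mul_unitarymx sigmaU); exact: phasemx_unitary.
pose B k := Theta (alpha k).
have BU k : (B k)^t* *m B k = 1%:M.
  exact/Theta_isometry/opnorm_contraction.
pose B' := decouple_at alpha k0 gamma1 gamma2.
have U12E : U12 = layers B' := cmvUgg_layers alpha k0 (phaseU t) (phaseU s).
have BB' k : k != k0 -> B k = B' k.
  by move=> /negPf kk; rewrite /B' /decouple_at kk.
have BU' k : (B' k)^t* *m B' k = 1%:M.
  rewrite /B' /decouple_at; case: ifP => _; last exact: BU.
  exact: (decoupled_isometry (phaseU t) (phaseU s)).
have [eqD gtD] := rank_layers_diff BU BB'.
have [eqR gtR] := rank_resolvent_diff BU BB' BU' zn1.
have rkP := rank_decoupled_phase (alpha_lt1 k0) sigmaU tauU alpha_k0 t s.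
have rk_ge := rank_decoupled_ge (alpha_lt1 k0) sigmaU tauU alpha_k0 gamma1 gamma2.
have EE : B k0 - B' k0 = Theta (alpha k0) - decoupled gamma1 gamma2.
  by rewrite /B' /decouple_at eqxx.
rewrite EE in eqD gtD eqR gtR.
have rk_gt : ~ angles ->
    (m < \rank (Theta (alpha k0) - decoupled gamma1 gamma2)%R)%N.
  by move=> nang; rewrite ltn_neqAle rk_ge andbT; apply/eqP => /esym/rkP.
rewrite -U12E in eqD gtD eqR gtR.
have gt_angles : ~ angles -> rank_gt D m /\ rank_gt Dres m.
  by move=> /rk_gt rk; split; [exact: gtD | exact: gtR].
split=> [gamma gammaU||| //].
- pose B0 k := Theta (replace alpha k0 gamma k).
  have BB0 k : k != k0 -> B k = B0 k by move=> /negPf kk; rewrite /B0 /replace kk.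
  have [_] := rank_layers_diff BU BB0; apply.
  rewrite /B0 /replace eqxx Theta_unitary//.
  exact: (rank_decoupled_unitary (alpha_lt1 k0) sigmaU tauU alpha_k0).
- split=> [eq_m|/rkP rk]; last by rewrite rk in eqD; exact: eqD.
  apply: contrapT => /gt_angles[gt_m _]; exact: rank_eq_gt_absurd eq_m gt_m.
- split=> [eq_m|/rkP rk]; last by rewrite rk in eqR; exact: eqR.
  apply: contrapT => /gt_angles[_ gt_m]; exact: rank_eq_gt_absurd eq_m gt_m.
Qed.
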